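(* Let $G$ be a finite simple graph, $\mathcal{C}$ a vertex cover of $G$ with a fixed cover map $\mathfrak{X}$, and suppose the minimal free resolution $\mathbb{G}$ of $Q/I(G)$ is a strictly commutative dg algebra. With $\tau:\mathbb{G}\to\mathbb{K}$, $\mu^z:\mathbb{K}\to\mathbb{F}$ and $\alpha=\mu^z\circ\tau$ as in the context, let $M=\operatorname{Cone}(\alpha_{\ge1})[1]$, and define $\bar\beta:M\to\mathbb{G}$ by $$\bar\beta(m)=\begin{cases}-zc, & m=(b,c) \text{ homogeneous of degree}\ge1,\\ \partial^{\mathbb{F}}(m), & m\in M_0=\mathbb{F}_1.\end{cases}$$ When $D(G,\mathcal{C})$ does not have any oriented cycles, $\operatorname{Cone}(\bar\beta)$ is the minimal free resolution of $Q/I(G^{\mathcal{C}})$. Furthermore, if $\tau$ is a dg morphism, then $\operatorname{Cone}(\bar\beta)$ is a (strictly commutative) dg algebra, i.e., it admits a multiplication making it, with its differential, a strictly commutative dg $Q$-algebra.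
   Context: Dg conventions: a dg $Q$-algebra is a nonnegatively graded associative unital $Q$-algebra with degree-$0$ part $Q$ and a degree $-1$ differential satisfying $\partial(ab)=\partial(a)b+(-1)^{|a|}a\partial(b)$; it is strictly commutative if $ab=(-1)^{|a||b|}ba$ for homogeneous $a,b$ and $a^2=0$ for $|a|$ odd. A dg morphism is a chain map that is a homomorphism of graded algebras. A dg ideal is a graded ideal closed under the differential. Graphs: $\Bbbk$ is a field, $V=V(G)$ is regarded as a set of variables, and an edge $\{a,b\}$ is identified with the monomial $ab$; $I(G)$ is the ideal generated by the edges. Let $z\notin V$ be a new variable and $Q=\Bbbk[V\cup\{z\}]$; all edge ideals are extended to $Q$. The suspension $G^{\mathcal{C}}$ is the graph on $V\cup\{z\}$ with edge set $E(G)\cup\{zx\mid x\in\mathcal{C}\}$. A cover map is a map $\mathfrak{X}:E(G)\to V$ with $\mathfrak{X}(w)\in\mathcal{C}$ an endpoint of $w$ for all $w$; the co-cover map is $\Upsilon(w)=w/\mathfrak{X}(w)$, the other endpoint. For $W\subseteq E(G)$ put $x_W=\operatorname{lcm}\{\mathfrak{X}(w):w\in W\}$, $y_W=\operatorname{lcm}\{\Upsilon(w):w\in W\}$, $d_W=\gcd\{x_W,y_W\}$. $D(G,\mathcal{C})$ is the directed graph on $V$ with a directed edge $(a,b)$ exactly when $\{a,b\}\in E(G)$ and $b=\mathfrak{X}(\{a,b\})$. Fix total orders on $\mathcal{C}$ and $E(G)$ such that $\mathfrak{X}(w)<\mathfrak{X}(w')$ implies $w<w'$. Complexes: the Taylor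 resolution on monomials $u_1,\dots,u_t$ (totally ordered) is the complex of free $Q$-modules with basis $g_U$ in degree $|U|$, $U\subseteq\{u_1,\dots,u_t\}$, and $\partial(g_U)=\sum_{u\in U}(-1)^{\sigma(u,U)}\frac{\operatorname{lcm}U}{\operatorname{lcm}(U\smallsetminus\{u\})}g_{U\smallsetminus\{u\}}$, $\sigma(u,U)=|\{v\in U:v<u\}|$; it is a strictly commutative dg algebra with $g_Ug_W=(-1)^{\sigma(U,W)}\frac{\operatorname{lcm}U\operatorname{lcm}W}{\operatorname{lcm}(U\cup W)}g_{U\cup W}$ if $U\cap W=\emptyset$ and $0$ otherwise, $\sigma(U,W)=|\{(v,w)\in U\times W:v>w\}|$. Let $\mathbb{T}$ be the Taylor resolution on $E(G)$ (basis $g_W$), $\mathbb{F}$ the Taylor resolution on $\{zx\mid x\in\mathcal{C}\}$ (basis $f_W$, ordered via $\mathcal{C}$), and $\mathbb{K}$ the Koszul complex on $\mathcal{C}$ (basis $e_W$, i.e. the Taylor resolution on $\mathcal{C}$). By a theorem of Katthän, $\mathbb{G}$ is identified as a dg algebra with $\mathbb{T}/\mathbb{J}$ for a dg ideal $\mathbb{J}$ of $\mathbb{T}$; choose a $Q$-basis of $\mathbb{G}$ consisting of images of certain $g_W$, again denoted $g_W$. Let $\tau:\mathbb{G}\to\mathbb{K}$ be the chain map lifting the surjection $Q/I(G)\to Q/\langle x\mid x\in\mathcal{C}\rangle$ given on basis elements by $\tau(1)=1$, $\tau(g_W)=\frac{y_W}{d_W}e_{W'}$, where $e_{W'}=e_{\mathfrak{X}(W)}$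 if $|\mathfrak{X}(W)|=|W|$ and $e_{W'}=0$ otherwise. Let $\mu^z:\mathbb{K}\to\mathbb{F}$ be the $Q$-linear chain map with $1\mapsto z$ and $e_{\{x_1,\dots,x_q\}}\mapsto f_{\{zx_1,\dots,zx_q\}}$. $\alpha_{\ge1}:\mathbb{G}_{\ge1}\to\mathbb{F}_{\ge1}$ is the restriction to the truncations in positive degrees, and $M=\operatorname{Cone}(\alpha_{\ge1})[1]$ is the complex with $M_0=\mathbb{F}_1$, $M_i=\mathbb{F}_{i+1}\oplus\mathbb{G}_i$ for $i\ge1$, $\partial^M(b,c)=(-\partial^{\mathbb{F}}b-\alpha(c),\partial^{\mathbb{G}}c)$ for degree $\ge2$ and $\partial^M(b,c)=-\partial^{\mathbb{F}}b-\alpha(c)$ in degree $1$. $\operatorname{Cone}(\bar\beta)$ has $\operatorname{Cone}(\bar\beta)_i=\mathbb{G}_i\oplus M_{i-1}$ and $\partial(a,m)=(\partial^{\mathbb{G}}a+\bar\beta(m),-\partial^Mm)$. *)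

(* Defs.v *)
From HB Require Import structures.
From mathcomp Require Import all_boot all_order all_algebra.
From mathcomp.multinomials Require Import mpoly.

Set Implicit Arguments.
Unset Strict Implicit.
Unset Printing Implicit Defensive.

Import GRing.Theory.
Local Open Scope ring_scope.

Definition mklin (R : pzRingType) (U V : lmodType R) (f : U -> V)
    (hf : linear f) : {linear U -> V} :=
  HB.pack f (GRing.isLinear.Build R U V *:%R f hf).

(* Sequences of modules and maps.  That consecutive differentials compose to  *)
(* zero is the separate predicate is_complex.  The differential out of        *)
(* degree 0 is zero.                                                          *)
Section Complexes.
Variable R : comNzRingType.

Record complex := Complex {
  obj :> nat -> lmodType R;
  dif : forall i, {linear obj i.+1 -> obj i} }.

Definition is_complex (A : complex) : Prop :=
  forall i (a : A i.+2), dif A i (dif A i.+1 a) = 0.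

Definition gmap (A B : complex) := forall i, {linear A i -> B i}.

Definition chain_map (A B : complex) (f : gmap A B) : Prop :=
  forall i (a : A i.+1), f i (dif A i a) = dif B i (f i.+1 a).

Definition is_basis (M : lmodType R) (I : finType) (b : I -> M) : Prop :=
  forall x : M, exists! c : {ffun I -> R}, x = \sum_i c i *: b i.

Definition fg_free (M : lmodType R) : Prop :=
  exists (r : nat) (b : 'I_r -> M), is_basis b.

(* The map aug stands for its composite with R -> R/I: that composite is onto *)
(* and its kernel is the image of dif A 0, so it identifies H_0(A) with R/I.  *)
Definition free_resolution (A : complex) (I : R -> Prop) : Prop :=
  [/\ is_complex A,
      forall i, fg_free (A i),
      forall i (a : A i.+1), dif A i a = 0 -> exists b, dif A i.+1 b = a
    & exists aug : {linear A 0%N -> R^o},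
        (forall q : R, exists a, I (aug a - q)) /\
        (forall a, I (aug a) <-> exists b, dif A 0%N b = a)].

(* The products A_i x A_j -> A_k carry a proof of i + j = k, so that the      *)
(* axioms below compare elements of one and the same module.                  *)
Definition products (A : complex) :=
  forall i j k : nat, (i + j)%N = k -> A i -> A j -> A k.

Record dg_algebra (A : complex) (one : A 0%N) (mul : products A) : Prop :=
  DgAlgebra {
  dga_complex : is_complex A;
  dga_linearl : forall i j k (e : (i + j)%N = k) (b : A j),
    linear (fun a : A i => mul i j k e a b);
  dga_linearr : forall i j k (e : (i + j)%N = k) (a : A i),
    linear (fun b : A j => mul i j k e a b);
  dga_onel : forall j (e : (0 + j)%N = j) (b : A j), mul 0%N j j e one b = b;
  dga_oner : forall i (e : (i + 0)%N = i) (a : A i), mul i 0%N i e a one = a;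
  dga_assoc : forall i j k ij jk l (e1 : (i + j)%N = ij) (e2 : (ij + k)%N = l)
      (e3 : (j + k)%N = jk) (e4 : (i + jk)%N = l) (a : A i) (b : A j) (c : A k),
    mul ij k l e2 (mul i j ij e1 a b) c = mul i jk l e4 a (mul j k jk e3 b c);
  dga_degree0 : forall a : A 0%N, exists! q : R, a = q *: one;
  dga_leibniz : forall i j k (e : (i.+1 + j.+1)%N = k.+1)
      (e1 : (i + j.+1)%N = k) (e2 : (i.+1 + j)%N = k) (a : A i.+1) (b : A j.+1),
    dif A k (mul i.+1 j.+1 k.+1 e a b)
      = mul i j.+1 k e1 (dif A i a) b
        + (-1) ^+ i.+1 *: mul i.+1 j k e2 a (dif A j b);
  dga_leibniz0l : forall j k (e : (0 + j.+1)%N = k.+1) (e' : (0 + j)%N = k)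
      (a : A 0%N) (b : A j.+1),
    dif A k (mul 0%N j.+1 k.+1 e a b) = mul 0%N j k e' a (dif A j b);
  dga_leibniz0r : forall i k (e : (i.+1 + 0)%N = k.+1) (e' : (i + 0)%N = k)
      (a : A i.+1) (b : A 0%N),
    dif A k (mul i.+1 0%N k.+1 e a b) = mul i 0%N k e' (dif A i a) b }.

Definition strictly_commutative (A : complex) (mul : products A) : Prop :=
  (forall i j k (e : (i + j)%N = k) (e' : (j + i)%N = k) (a : A i) (b : A j),
     mul i j k e a b = (-1) ^+ (i * j)%N *: mul j i k e' b a) /\
  (forall i k (e : (i + i)%N = k) (a : A i), odd i -> mul i i k e a a = 0).

Definition dg_morphism (A B : complex) (oneA : A 0%N) (mulA : products A)
    (oneB : B 0%N) (mulB : products B) (f : gmap A B) : Prop :=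
  [/\ chain_map f,
      f 0%N oneA = oneB
    & forall i j k (e : (i + j)%N = k) (a : A i) (b : A j),
        f k (mulA i j k e a b) = mulB i j k e (f i a) (f j b)].

Definition dg_ideal (A : complex) (mul : products A)
    (J : forall i, A i -> Prop) : Prop :=
  [/\ forall i, J i 0,
      forall i (q : R) (x y : A i), J i x -> J i y -> J i (q *: x + y),
      forall i j k (e : (i + j)%N = k) (a : A i) (x : A j),
        J j x -> J k (mul i j k e a x),
      forall i j k (e : (i + j)%N = k) (x : A i) (a : A j),
        J i x -> J k (mul i j k e x a)
    & forall i (x : A i.+1), J i.+1 x -> J i (dif A i x)].

(* pi identifies B, as a dg algebra, with the quotient A/J. *)
Definition dg_quotient (A B : complex) (oneA : A 0%N) (mulA : products A)
    (oneB : B 0%N) (mulB : products B)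
    (J : forall i, A i -> Prop) (pi : gmap A B) : Prop :=
  [/\ dg_morphism oneA mulA oneB mulB pi,
      forall i (b : B i), exists a, pi i a = b
    & forall i (a : A i), pi i a = 0 <-> J i a].

Section Cones.
Variables (A F : complex) (alpha : gmap A F).

(* M = Cone(alpha_{>=1})[1] *)
Definition M_obj (i : nat) : lmodType R :=
  match i with 0%N => F 1%N | i'.+1 => (F i'.+2 * A i'.+1)%type end.

Definition M_dif_fun (i : nat) : M_obj i.+1 -> M_obj i :=
  match i return M_obj i.+1 -> M_obj i with
  | 0%N => fun m => - dif F 1%N m.1 - alpha 1%N m.2
  | i'.+1 => fun m =>
      (- dif F i'.+2 m.1 - alpha i'.+2 m.2, dif A i'.+1 m.2)
  end.

Lemma M_dif_linear i : linear (@M_dif_fun i).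
Proof.
have h j q (x y : F j.+2 * A j.+1) :
    - dif F j.+1 (q *: x + y).1 - alpha j.+1 (q *: x + y).2
    = q *: (- dif F j.+1 x.1 - alpha j.+1 x.2)
      + (- dif F j.+1 y.1 - alpha j.+1 y.2) :> F j.+1.
  by rewrite /= !linearP scalerDr addrACA.
case: i => [|i] q x y; first exact: h.
by rewrite /M_dif_fun h /= linearP.
Qed.

Definition M_complex : complex :=
  Complex (fun i => mklin (@M_dif_linear i)).
End Cones.

Section MappingCone.
Variables (A M : complex) (beta : gmap M A).

Definition cone_obj (i : nat) : lmodType R :=
  match i with 0%N => A 0%N | i'.+1 => (A i'.+1 * M i')%type end.

Definition cone_dif_fun (i : nat) : cone_obj i.+1 -> cone_obj i :=
  match i return cone_obj i.+1 -> cone_obj i with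
  | 0%N => fun x => dif A 0%N x.1 + beta 0%N x.2
  | i'.+1 => fun x =>
      (dif A i'.+1 x.1 + beta i'.+1 x.2, - dif M i' x.2)
  end.

Lemma cone_dif_linear i : linear (@cone_dif_fun i).
Proof.
have h j q (x y : A j.+1 * M j) :
    dif A j (q *: x + y).1 + beta j (q *: x + y).2
    = q *: (dif A j x.1 + beta j x.2) + (dif A j y.1 + beta j y.2) :> A j.
  by rewrite /= !linearP scalerDr addrACA.
case: i => [|i] q x y; first exact: h.
by rewrite /cone_dif_fun h /= linearP opprD -scalerN.
Qed.

Definition cone : complex := Complex (fun i => mklin (@cone_dif_linear i)).
End MappingCone.

Definition comp_gmap (A B C : complex) (g : gmap B C) (f : gmap A B) :
  gmap A C := fun i => g i \o f i.

End Complexes.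

(* Graphs are given by their sets of edges, on a vertex set 'I_n. *)
Definition simple_graph (n : nat) (E : {set {set 'I_n}}) : Prop :=
  {in E, forall w : {set 'I_n}, #|w| = 2%N}.

Definition vertex_cover (n : nat) (E : {set {set 'I_n}}) (C : {set 'I_n}) :
  Prop := {in E, forall w : {set 'I_n}, exists2 v, v \in C & v \in w}.

Definition cover_map (n : nat) (E : {set {set 'I_n}}) (C : {set 'I_n})
    (X : {set 'I_n} -> 'I_n) : Prop :=
  {in E, forall w : {set 'I_n}, X w \in C /\ X w \in w}.

Definition cover_digraph (n : nat) (E : {set {set 'I_n}})
    (X : {set 'I_n} -> 'I_n) : rel 'I_n :=
  fun a b => ([set a; b] \in E) && (b == X [set a; b]).

Definition no_oriented_cycle (n : nat) (D : rel 'I_n) : Prop :=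
  forall c : seq 'I_n, c != [::] -> ~ ucycle D c.

Definition strict_total_order (T : finType) (S : {set T}) (lt : rel T) : Prop :=
  [/\ {in S, forall x, ~~ lt x x},
      {in S & S & S, forall y x z, lt x y -> lt y z -> lt x z}
    & {in S &, forall x y, x != y -> lt x y || lt y x}].

(* In Q = k[x_0, .., x_(n-1), z] the vertex v is the variable of index        *)
(* vert v, and z is the last variable.                                        *)
Definition vert (n : nat) (v : 'I_n) : 'I_n.+1 := widen_ord (leqnSn n) v.

Definition extend_graph (n : nat) (E : {set {set 'I_n}}) :
    {set {set 'I_n.+1}} :=
  [set (@vert n) @: w | w : {set 'I_n} in E].

Definition suspension (n : nat) (E : {set {set 'I_n}}) (C : {set 'I_n}) :
    {set {set 'I_n.+1}} :=
  extend_graph E :|: [set [set ord_max; vert v] | v in C].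

Definition edge_ideal (k : fieldType) (N : nat) (E : {set {set 'I_N}})
    (p : {mpoly k[N]}) : Prop :=
  exists c : {set 'I_N} -> {mpoly k[N]},
    p = \sum_(w in E) c w * \prod_(v in w) 'X_v.

Definition gcdm (N : nat) (m1 m2 : 'X_{1..N}) : 'X_{1..N} :=
  [multinom minn (m1 i) (m2 i) | i < N].

Definition lcm_set (N : nat) (I : finType) (u : I -> 'X_{1..N}) (U : {set I}) :
    'X_{1..N} :=
  \big[@mlcm N/0%MM]_(i in U) u i.

Section Minimal.
Variables (k : fieldType) (N : nat).
Notation Q := {mpoly k[N]}.

Definition minimal (A : complex Q) : Prop :=
  forall i (a : A i.+1), exists c : 'I_N -> A i,
    dif A i a = \sum_(v < N) 'X_v *: c v.

Definition minimal_free_resolution (A : complex Q) (I : Q -> Prop) : Prop :=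
  free_resolution A I /\ minimal A.

Definition multigraded_by (A : complex Q) (X : nat -> finType)
    (b : forall i, X i -> A i) (deg : forall i, X i -> 'X_{1..N}) : Prop :=
  (forall i, is_basis (b i)) /\
  (forall i (x : X i.+1), exists c : X i -> k,
     dif A i (b i.+1 x)
     = \sum_(y | (deg i y <= deg i.+1 x)%MM)
         ((c y)%:MP * 'X_[(deg i.+1 x - deg i y)%MM]) *: b i y).

Definition multigraded (A : complex Q) : Prop :=
  exists (X : nat -> finType) (b : forall i, X i -> A i)
    (deg : forall i, X i -> 'X_{1..N}), multigraded_by b deg.
End Minimal.

(* The Taylor resolution on the monomials u i, for i in S, which are ordered  *)
(* by lt.  In degree i its elements are the coordinate vectors with respect   *)
(* to the basis formed by the subsets of S with i elements.                   *)
Section Taylor.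
Variables (k : fieldType) (N : nat) (I : finType) (S : {set I}) (lt : rel I)
  (u : I -> 'X_{1..N}).
Notation Q := {mpoly k[N]}.

Definition cell (i : nat) := {U : {set I} | (U \subset S) && (#|U| == i)}.

Definition taylor_obj (i : nat) : lmodType Q := {ffun cell i -> Q^o}.

(* g_U, or 0 if U is not a subset of S with i elements. *)
Definition tgen (i : nat) (U : {set I}) : taylor_obj i :=
  [ffun U' : cell i => (val U' == U)%:R].

Definition tsign (U W : {set I}) : nat :=
  #|[set p : I * I | [&& p.1 \in U, p.2 \in W & lt p.2 p.1]]|.

(* The coefficient of g_(U') in the differential of g_U. *)
Definition taylor_dcoef (U U' : {set I}) : Q :=
  \sum_(x in U | U' == U :\ x)
    (-1) ^+ tsign [set x] U * 'X_[(lcm_set u U - lcm_set u (U :\ x))%MM].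

Definition taylor_dif_fun (i : nat) (f : taylor_obj i.+1) : taylor_obj i :=
  [ffun U' : cell i =>
     \sum_(U : cell i.+1) f U * taylor_dcoef (val U) (val U')].

Lemma taylor_dif_linear i : linear (@taylor_dif_fun i).
Proof.
move=> q x y; apply/ffunP=> U; rewrite !ffunE /GRing.scale /=.
rewrite mulr_sumr -big_split /=; apply: eq_bigr => W _.
by rewrite !ffunE mulrDl mulrA.
Qed.

Definition taylor : complex Q :=
  Complex (fun i => mklin (@taylor_dif_linear i)).

Definition taylor_one : taylor 0%N := tgen 0 set0.

(* The coefficient of g_V in g_U g_W. *)
Definition taylor_mcoef (U W V : {set I}) : Q :=
  if [disjoint U & W] && (V == U :|: W) then
    (-1) ^+ tsign U W
    * 'X_[(lcm_set u U + lcm_set u W - lcm_set u (U :|: W))%MM]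
  else 0.

Definition taylor_mul : products taylor :=
  fun i j l _ (f : taylor_obj i) (g : taylor_obj j) =>
    [ffun V : cell l =>
       \sum_(U : cell i) \sum_(W : cell j)
         f U * g W * taylor_mcoef (val U) (val W) (val V)] : taylor_obj l.

(* The isomorphism from the degree 0 part to Q. *)
Definition taylor0 (f : taylor 0%N) : Q := \sum_(U : cell 0) (f : taylor_obj 0) U.
End Taylor.

Arguments taylor k {N I} S lt u.
Arguments taylor_one k {N I} S lt u.
Arguments taylor_mul : clear implicits.
Arguments tgen {k N I} S i U.

Section Suspension.
Variables (k : fieldType) (n : nat).
Variables (E : {set {set 'I_n}}) (C : {set 'I_n}) (X : {set 'I_n} -> 'I_n).
Variables (ltE : rel {set 'I_n}) (ltC : rel 'I_n).
Notation Q := {mpoly k[n.+1]}.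

Definition vert_mon (v : 'I_n) : 'X_{1..n.+1} := U_(vert v)%MM.
Definition z_mon : 'X_{1..n.+1} := U_(ord_max)%MM.
Definition edge_mon (w : {set 'I_n}) : 'X_{1..n.+1} :=
  \big[+%MM/0%MM]_(v in w) vert_mon v.

Definition x_lcm (W : {set {set 'I_n}}) : 'X_{1..n.+1} :=
  lcm_set (fun w => vert_mon (X w)) W.
Definition y_lcm (W : {set {set 'I_n}}) : 'X_{1..n.+1} :=
  lcm_set (fun w => edge_mon w - vert_mon (X w))%MM W.
Definition xy_gcd (W : {set {set 'I_n}}) : 'X_{1..n.+1} :=
  gcdm (x_lcm W) (y_lcm W).

Definition taylorT : complex Q := taylor k E ltE edge_mon.
Definition taylorT_one : taylorT 0%N := taylor_one k E ltE edge_mon.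
Definition taylorT_mul : products taylorT := taylor_mul k _ _ E ltE edge_mon.

Definition koszulK : complex Q := taylor k C ltC vert_mon.
Definition koszulK_one : koszulK 0%N := taylor_one k C ltC vert_mon.
Definition koszulK_mul : products koszulK := taylor_mul k _ _ C ltC vert_mon.

(* The Taylor resolution on the monomials z x, each indexed by x. *)
Definition taylorF : complex Q := taylor k C ltC (fun v => z_mon + vert_mon v)%MM.

(* K and F have the same coordinates in each degree, since f_{zx : x in U} is *)
(* indexed by U. *)
Definition muz_fun (i : nat) : koszulK i -> taylorF i :=
  match i return koszulK i -> taylorF i with
  | 0%N => fun x => 'X_ord_max *: x
  | i'.+1 => fun x => x
  end.

Lemma muz_linear i : linear (@muz_fun i).
Proof.
case: i => [|i] q x y //=.
by rewrite scalerDr !scalerA mulrC.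
Qed.

Definition muz : gmap koszulK taylorF := fun i => mklin (@muz_linear i).

Section Quotient.
Variables (G : complex Q) (pi : gmap taylorT G) (B : {set {set {set 'I_n}}}).

Definition cellB (i : nat) := {W : cell E i | val W \in B}.

Definition basisG (i : nat) (W : cellB i) : G i :=
  pi i (tgen E i (val (val W))).

Definition degG (i : nat) (W : cellB i) : 'X_{1..n.+1} :=
  lcm_set edge_mon (val (val W)).

Definition tau_formula (tau : gmap G koszulK) : Prop :=
  forall i (W : cellB i),
    tau i (basisG W) =
      'X_[(y_lcm (val (val W)) - xy_gcd (val (val W)))%MM] *:
        (if #|X @: val (val W)| == #|val (val W)|
         then tgen C i (X @: val (val W)) else 0).
End Quotient.

Section Beta.
Variables (G : complex Q) (oneG : G 0%N) (tau : gmap G koszulK).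

Definition alpha : gmap G taylorF := comp_gmap muz tau.

(* In degree 0 the differential of F takes its values in F_0 = Q, which is    *)
(* identified with G_0 by 1 |-> oneG. *)
Definition beta_fun (i : nat) : M_complex alpha i -> G i :=
  match i return M_complex alpha i -> G i with
  | 0%N => fun m => taylor0 (dif taylorF 0%N m) *: oneG
  | i'.+1 => fun m => - ('X_ord_max *: m.2)
  end.

Lemma beta_linear i : linear (@beta_fun i).
Proof.
case: i => [|i] q x y.
  rewrite /beta_fun linearP /taylor0 scalerA -scalerDl; congr (_ *: _).
  rewrite mulr_sumr -big_split /=; apply: eq_bigr => U _.
  by rewrite !ffunE.
rewrite /beta_fun /= scalerDr opprD scalerN; congr (- _ - _).
by rewrite !scalerA mulrC.
Qed.

Definition beta : gmap (M_complex alpha) G := fun i => mklin (@beta_linear i).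
End Beta.
End Suspension.

Arguments taylorT k {n} E ltE.
Arguments taylorT_one k {n} E ltE.
Arguments taylorT_mul : clear implicits.
Arguments koszulK k {n} C ltC.
Arguments koszulK_one k {n} C ltC.
Arguments koszulK_mul : clear implicits.
Arguments edge_ideal k {N} E p.
Arguments basisG {k n E ltE G} pi B i W.
Arguments degG {n} E B i W.

(* Main.v *)
(* F and K have the same modules in degrees i >= 1; there alpha is tau, and
   the differential of F is that of K in degrees i >= 2 and z times it in
   degree 1.  So Cone(beta) consists of triples (a, b, c) in G x K x G with
     d(a, b, c) = (da - z c, db + tau c, - dc),
   except that d(a, b) = da + z db in degree 1.

   Exactness.  A cycle (a, b) of degree 1 has z db in I(G), hence db in I(G)
   since z is regular modulo I(G), which lets one correct b to a cycle of K.
   In higher degrees c is a boundary of G, and subtracting a boundary leaves a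
   cycle of G and a cycle of K.

   Minimality.  The entries of tau are the y_W / d_W with the cover map
   injective on W.  If one of them were 1, every co-cover of an edge of W would
   be the cover of another edge of W, and following these edges would produce
   an oriented cycle.

   Multiplication.  Let G[y] be G with an exterior variable y of degree 1 and
   dy = - z.  The chain map
     (a, b, c) |-> (a + y c, tau a + z b),   (a, b) |-> (a - y db, tau a + z b)
   embeds Cone(beta) into the product of the dg algebras G[y] and K.  If tau is
   multiplicative, the image is closed under products, because
     (tau a + z b) (tau a' + z b')
       = tau (a a') + z (tau a b' + b tau a' + z b b'). *)

Require Import Defs.
From HB Require Import structures.
From mathcomp Require Import all_boot all_order all_algebra.
From mathcomp.multinomials Require Import mpoly.
From mathcomp Require Import zify.

Set Implicit Arguments.
Unset Strict Implicit.
Unset Printing Implicit Defensive.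

Import GRing.Theory.
Local Open Scope ring_scope.

(** * Signs and least common multiples *)

(** The terms at (x, y) and (y, x) cancel. The pairs are separated by a total order on the index
    type instead of dividing by 2, so characteristic 2 is covered; there the vanishing on the
    diagonal does not follow from antisymmetry. *)
Lemma alternating_sum (I : finType) (V : zmodType) (h : I -> I -> V) :
  (forall x, h x x = 0) -> (forall x y, h x y = - h y x) ->
  \sum_x \sum_y h x y = 0.
Proof.
move=> h0 hN.
pose lt (x y : I) := (enum_rank x < enum_rank y)%N.
have split x : \sum_y h x y = \sum_(y | lt x y) h x y + \sum_(y | lt y x) h x y.
  rewrite (bigID (lt x)) /=; congr (_ + _).
  rewrite (bigD1 x) /=; last by rewrite /lt ltnn.
  rewrite h0 add0r; apply: eq_bigl => y; rewrite /lt -leqNgt leq_eqVlt.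
  have -> : (enum_rank y == enum_rank x :> nat) = (y == x).
    by rewrite (inj_eq val_inj) (inj_eq enum_rank_inj).
  by case: eqVneq => [->|_]; rewrite ?ltnn ?andbT.
rewrite (eq_bigr _ (fun x _ => split x)) big_split /=.
rewrite [X in _ + X](exchange_big_dep xpredT) //= -big_split big1 //= => x _.
by rewrite -big_split big1 //= => y _; rewrite hN addNr.
Qed.

Lemma signr_eq (R : pzRingType) a b :
  odd a = odd b -> (-1) ^+ a = (-1) ^+ b :> R.
Proof. by move=> h; rewrite -signr_odd h signr_odd. Qed.

Lemma signr_neq (R : pzRingType) a b :
  odd a = ~~ odd b -> (-1) ^+ a = - (-1) ^+ b :> R.
Proof. by move=> h; rewrite -signr_odd h signrN signr_odd. Qed.

(** This and the following lemmas serve maps given as plain functions with a proof of linearity,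
    such as a product with one factor fixed. *)
Lemma linear0_of (R : pzRingType) (U V : lmodType R) (f : U -> V) :
  linear f -> f 0 = 0.
Proof. by move=> hf; exact: (raddf0 (mklin hf)). Qed.

Lemma linearZ_of (R : pzRingType) (U V : lmodType R) (f : U -> V) :
  linear f -> forall q x, f (q *: x) = q *: f x.
Proof.
by move=> hf q x; have := hf q x 0; rewrite (linear0_of hf) !addr0.
Qed.

Lemma linearD_of (R : pzRingType) (U V : lmodType R) (f : U -> V) :
  linear f -> forall x y, f (x + y) = f x + f y.
Proof. by move=> hf; exact: (raddfD (mklin hf)). Qed.

Lemma linearN_of (R : pzRingType) (U V : lmodType R) (f : U -> V) :
  linear f -> forall x, f (- x) = - f x.
Proof. by move=> hf; exact: (raddfN (mklin hf)). Qed.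

Lemma linear_sum_of (R : pzRingType) (U V : lmodType R) (f : U -> V) :
  linear f -> forall (I : Type) (r : seq I) (P : pred I) (F : I -> U),
  f (\sum_(i <- r | P i) F i) = \sum_(i <- r | P i) f (F i).
Proof. by move=> hf; exact: (raddf_sum (mklin hf)). Qed.

Section Differential.
Variables (R : comNzRingType) (A : complex R) (i : nat).

Lemma difZ q a : dif A i (q *: a) = q *: dif A i a.
Proof. exact: linearZ_of (linearP (dif A i)) q a. Qed.

Lemma difD a b : dif A i (a + b) = dif A i a + dif A i b.
Proof. exact: raddfD. Qed.

Lemma difN a : dif A i (- a) = - dif A i a.
Proof. exact: raddfN. Qed.

Lemma dif0 : dif A i 0 = 0.
Proof. exact: raddf0. Qed.

Lemma dif_sum (J : Type) (r : seq J) (P : pred J) (F : J -> A i.+1) :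
  dif A i (\sum_(j <- r | P j) F j) = \sum_(j <- r | P j) dif A i (F j).
Proof. exact: raddf_sum. Qed.

Lemma dif_linear : linear (dif A i).
Proof. exact: linearP. Qed.

End Differential.

Section LcmSet.
Variables (N : nat) (I : finType) (u : I -> 'X_{1..N}).
Implicit Types U W : {set I}.

Lemma lcm_setE U j : lcm_set u U j = \max_(x in U) u x j.
Proof.
rewrite /lcm_set; elim/big_rec2: _ => [|x m1 m2 _ <-]; first by rewrite mnm0E.
by rewrite /mlcm mnmE.
Qed.

Lemma leq_lcm_set U W j : U \subset W -> (lcm_set u U j <= lcm_set u W j)%N.
Proof.
move=> /subsetP sUW; rewrite !lcm_setE; apply/bigmax_leqP => x xU.
exact: leq_bigmax_cond (sUW x xU).
Qed.

Lemma lcm_setU U W j :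
  lcm_set u (U :|: W) j = maxn (lcm_set u U j) (lcm_set u W j).
Proof.
apply/eqP; rewrite eqn_leq; apply/andP; split; last first.
  by rewrite geq_max !leq_lcm_set ?subsetUl ?subsetUr.
rewrite !lcm_setE; apply/bigmax_leqP => x; rewrite leq_max.
case/setUP => h; apply/orP; [left|right]; exact: leq_bigmax_cond h.
Qed.

Lemma lcm_set0 : lcm_set u set0 = 0%MM.
Proof. by rewrite /lcm_set big_set0. Qed.

Lemma lcm_set1 x : lcm_set u [set x] = u x.
Proof. by apply/mnmP => j; rewrite lcm_setE big_set1. Qed.

End LcmSet.

(** * Counting inversions between finite sets *)

Section TaylorSign.
Variables (I : finType) (S : {set I}) (lt : rel I).
Hypothesis ltS : strict_total_order S lt.
Implicit Types U W Z : {set I}.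

Lemma tsignE U W : tsign lt U W = (\sum_(x in U) \sum_(y in W) lt y x)%N.
Proof.
rewrite /tsign -sum1_card pair_big /= [RHS]big_mkcond /= big_mkcond /=.
apply: eq_bigr => -[x y] _ /=; rewrite inE /= andbA.
by case: (x \in U); case: (y \in W) => //=; case: (lt y x).
Qed.

Lemma tsignUl U W Z :
  [disjoint U & W] -> tsign lt (U :|: W) Z = (tsign lt U Z + tsign lt W Z)%N.
Proof.
by move=> h; rewrite !tsignE -bigU //=; apply: eq_bigl => x; rewrite inE.
Qed.

Lemma tsignUr U W Z :
  [disjoint W & Z] -> tsign lt U (W :|: Z) = (tsign lt U W + tsign lt U Z)%N.
Proof.
move=> h; rewrite !tsignE -big_split; apply: eq_bigr => x _ /=.
by rewrite -bigU //=; apply: eq_bigl => y; rewrite inE.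
Qed.

Lemma lt_sym x y : x \in S -> y \in S -> x != y -> lt y x = ~~ lt x y.
Proof.
case: ltS => irr tr tot xS yS xy.
have := tot x y xS yS xy; case: (boolP (lt x y)) => //= xly _.
apply/negP => ylx; move/negP: (irr x xS); apply; exact: (tr y x x).
Qed.

(** Each pair in U x W is an inversion in exactly one of the two orders. *)
Lemma tsignC U W : U \subset S -> W \subset S -> [disjoint U & W] ->
  (tsign lt U W + tsign lt W U = #|U| * #|W|)%N.
Proof.
move=> /subsetP sU /subsetP sW dUW; rewrite !tsignE [X in (_ + X)%N]exchange_big /=.
rewrite -big_split /= -sum_nat_const; apply: eq_bigr => x xU.
rewrite -big_split /= -sum1_card; apply: eq_bigr => y yW.
rewrite (lt_sym (sU _ xU) (sW _ yW)); first by case: lt.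
by apply: contraTneq yW => <-; rewrite (disjointFr dUW).
Qed.

Lemma tsign11 x : x \in S -> tsign lt [set x] [set x] = 0%N.
Proof. by case: ltS => irr _ _ /irr h; rewrite tsignE !big_set1 (negPf h). Qed.

Lemma tsign1D x U : x \in U -> U \subset S ->
  tsign lt [set x] U = tsign lt [set x] (U :\ x).
Proof.
move=> xU /subsetP sU; rewrite -{1}(setD1K xU) tsignUr ?tsign11 ?sU //.
by rewrite disjoints1 in_setD1 eqxx.
Qed.

Lemma tsignD1l U W x : x \in U ->
  tsign lt U W = (tsign lt [set x] W + tsign lt (U :\ x) W)%N.
Proof.
by move=> xU; rewrite -{1}(setD1K xU) tsignUl // disjoints1 in_setD1 eqxx.
Qed.

Lemma tsignD1r U W x : x \in W ->
  tsign lt U W = (tsign lt U [set x] + tsign lt U (W :\ x))%N.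
Proof.
by move=> xW; rewrite -{1}(setD1K xW) tsignUr // disjoints1 in_setD1 eqxx.
Qed.

(** Deleting x lowers the position of y by one exactly when x precedes y, and exactly one of x, y
    precedes the other. This is the sign behind the vanishing of the squared Taylor differential. *)
Lemma odd_tsign_swap U x y : U \subset S -> x \in U -> y \in U -> x != y ->
  odd (tsign lt [set x] U + tsign lt [set y] (U :\ x))
  = ~~ odd (tsign lt [set y] U + tsign lt [set x] (U :\ y)).
Proof.
move=> sU xU yU xy.
have Eyx : U :\ y :\ x = U :\ x :\ y by rewrite !setDDl setUC.
have xy' : y \in U :\ x by rewrite in_setD1 eq_sym xy.
have yx' : x \in U :\ y by rewrite in_setD1 xy.
have sUx : U :\ x \subset S by rewrite (subset_trans (subD1set _ _)).
have sUy : U :\ y \subset S by rewrite (subset_trans (subD1set _ _)).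
have xS := subsetP sU _ xU; have yS := subsetP sU _ yU.
rewrite (tsign1D xU) // (tsign1D yU) // (tsign1D xy') // (tsign1D yx') // Eyx.
rewrite (tsignD1r [set x] xy') (tsignD1r [set y] yx') Eyx.
have := tsignC (U := [set x]) (W := [set y]).
rewrite !sub1set xS yS disjoints1 in_set1 xy !cards1 => /(_ isT isT isT).
move: (tsign lt [set x] [set y]) (tsign lt [set y] [set x]) => a b.
move: (tsign lt [set x] _) (tsign lt [set y] _) => c d; clear; lia.
Qed.

End TaylorSign.

(** * The Taylor resolution as a dg algebra *)

Section TaylorCoefficients.
Variables (k : fieldType) (N : nat) (I : finType) (S : {set I}) (lt : rel I).
Variable u : I -> 'X_{1..N}.
Hypothesis ltS : strict_total_order S lt.
Implicit Types U W Z : {set I}.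
Notation Q := {mpoly k[N]}.

(** The entries of [taylor_dcoef] indexed by the deleted element, so that the boundary of a
    generator is a sum over U. Likewise [prod_coef] is [taylor_mcoef] at the union. *)
Definition face_coef U x : Q :=
  (-1) ^+ tsign lt [set x] U * 'X_[(lcm_set u U - lcm_set u (U :\ x))%MM].

Definition prod_coef U W : Q :=
  if [disjoint U & W] then
    (-1) ^+ tsign lt U W
    * 'X_[(lcm_set u U + lcm_set u W - lcm_set u (U :|: W))%MM]
  else 0.

Lemma face_coef_swap U x y : U \subset S -> x \in U -> y \in U -> x != y ->
  face_coef U x * face_coef (U :\ x) y = - (face_coef U y * face_coef (U :\ y) x).
Proof.
move=> sU xU yU xy.
have Eyx : U :\ y :\ x = U :\ x :\ y by rewrite !setDDl setUC.
have sgn := signr_neq Q (odd_tsign_swap ltS sU xU yU xy).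
rewrite /face_coef [LHS]mulrACA [in RHS]mulrACA -!exprD -!mpolyXD sgn mulNr.
congr (- (_ * 'X_[_])); apply/mnmP => j; rewrite !(mnmDE, mnmBE) Eyx.
have := leq_lcm_set u j (subD1set U x).
have := leq_lcm_set u j (subD1set U y).
have := leq_lcm_set u j (subD1set (U :\ x) y).
have := leq_lcm_set u j (subD1set (U :\ y) x); rewrite Eyx.
lia.
Qed.

(** The family [g] is arbitrary, which keeps the degrees of the generators out of the
    computation. *)
Lemma face_sum_sq0 (V : lmodType Q) (g : {set I} -> V) U : U \subset S ->
  \sum_(x in U) face_coef U x *: \sum_(y in U :\ x)
     face_coef (U :\ x) y *: g (U :\ x :\ y) = 0.
Proof.
(* Extension by zero turns the iterated sum into one over all pairs, antisymmetric by
   [face_coef_swap]. *)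
move=> sU; pose h x y : V :=
  if [&& x \in U, y \in U & x != y]
  then (face_coef U x * face_coef (U :\ x) y) *: g (U :\ x :\ y) else 0.
rewrite -[RHS](@alternating_sum I V h) => [|x|x y].
- rewrite big_mkcond; apply: eq_bigr => x _.
  case: ifP => xU; last by rewrite big1 // => y _; rewrite /h xU.
  rewrite scaler_sumr big_mkcond; apply: eq_bigr => y _.
  by rewrite /h xU in_setD1 eq_sym andbC /=; case: ifP => // _; rewrite scalerA.
- by rewrite /h eqxx !andbF.
rewrite /h [y == x]eq_sym [in RHS]andbCA.
case: ifP => [/and3P[xU yU xy]|_]; last by rewrite oppr0.
by rewrite face_coef_swap // scaleNr !setDDl setUC.
Qed.

(** As x is not in W, deleting it commutes with the union, and lcm(U :|: W) drops out of the
    exponent on the left. *)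
Lemma face_prodl U W x :
  U \subset S -> W \subset S -> x \in U -> [disjoint U & W] ->
  prod_coef U W * face_coef (U :|: W) x = face_coef U x * prod_coef (U :\ x) W.
Proof.
move=> sU sW xU dUW; have xS := subsetP sU _ xU.
have xW : x \notin W by rewrite (disjointFr dUW).
have dx : [disjoint U :\ x & W] by rewrite (disjointWl (subD1set _ _)).
have Ex : (U :|: W) :\ x = U :\ x :|: W.
  rewrite setDUl; congr (_ :|: _); apply/setDidPl.
  by rewrite disjoint_sym disjoints1.
rewrite /prod_coef dUW dx /face_coef [LHS]mulrACA [in RHS]mulrACA.
rewrite -!exprD -!mpolyXD Ex; congr (_ * 'X_[_]).
  apply: signr_eq; rewrite tsignUr // (tsignD1l lt W xU).
  lia.
apply/mnmP => j; rewrite !(mnmDE, mnmBE) !lcm_setU.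
have := leq_lcm_set u j (subD1set U x); lia.
Qed.

Lemma prod_coefC U W : U \subset S -> W \subset S ->
  prod_coef U W = (-1) ^+ (#|U| * #|W|) * prod_coef W U.
Proof.
move=> sU sW; rewrite /prod_coef disjoint_sym; case: ifP; rewrite ?mulr0 // => d.
rewrite mulrA -exprD setUC addmC; congr (_ * _); apply: signr_eq.
by rewrite -(tsignC ltS) 1?disjoint_sym // -addnA addnn oddD odd_double addbF.
Qed.

Lemma face_prodr U W x :
  U \subset S -> W \subset S -> x \in W -> [disjoint U & W] ->
  prod_coef U W * face_coef (U :|: W) x
  = (-1) ^+ #|U| * (face_coef W x * prod_coef U (W :\ x)).
Proof.
move=> sU sW xW dUW.
have sWx : W :\ x \subset S by rewrite (subset_trans (subD1set _ _)).
rewrite prod_coefC // -mulrA setUC face_prodl 1?disjoint_sym //.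
rewrite [prod_coef U (W :\ x)]prod_coefC // [face_coef W x * (_ * _)]mulrCA.
rewrite [RHS]mulrA -exprD (cardsD1 x W) xW; congr (_ * _); apply: signr_eq.
by rewrite mulnDr muln1.
Qed.

(** For a common element x the product of g_U and g_W is zero, but deleting x from one factor may
    leave a nonzero product. Both deletions lead to the same union, and the two Leibniz terms have
    opposite signs. *)
Lemma face_prod_cancel U W x : U \subset S -> W \subset S ->
    x \in U -> x \in W ->
  face_coef U x * prod_coef (U :\ x) W
  = - ((-1) ^+ #|U| * (face_coef W x * prod_coef U (W :\ x))).
Proof.
move=> sU sW xU xW; have xS := subsetP sU _ xU.
have Ed : [disjoint U & W :\ x] = [disjoint U :\ x & W].
  by rewrite -!setI_eq0 !setDE setIA setIAC.
rewrite /prod_coef Ed; case: ifP => d; last by rewrite !mulr0 oppr0.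
have EU : U :\ x :|: W = U :|: W.
  by apply/setP => y; rewrite !inE; case: eqVneq => [->|//]; rewrite xU xW.
have EW : U :|: W :\ x = U :|: W.
  by apply/setP => y; rewrite !inE; case: eqVneq => [->|//]; rewrite xU.
rewrite EU EW /face_coef [LHS]mulrACA [X in _ = - (_ * X)]mulrACA [X in _ = - X]mulrA.
rewrite -!exprD -!mpolyXD -mulNr; congr (_ * 'X_[_]).
  apply: signr_neq.
  rewrite (tsign1D ltS xU) // (tsign1D ltS xW) //.
  rewrite (tsignD1r lt (U :\ x) xW) (tsignD1l lt (W :\ x) xU).
  have := tsignC ltS (U := [set x]) (W := U :\ x).
  rewrite sub1set (subset_trans (subD1set _ _)) // disjoints1 in_setD1 eqxx.
  move=> /(_ xS isT isT); rewrite cards1 (cardsD1 x U) xU.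
  lia.
apply/mnmP => j; rewrite !(mnmDE, mnmBE) !lcm_setU.
have := leq_lcm_set u j (subD1set U x).
have := leq_lcm_set u j (subD1set W x).
have := lcm_setU u (U :\ x) W j; rewrite EU lcm_setU.
have := lcm_setU u U (W :\ x) j; rewrite EW lcm_setU.
lia.
Qed.

Lemma face_prod_leibniz (V : lmodType Q) (g : {set I} -> V) U W :
  U \subset S -> W \subset S ->
  prod_coef U W *: \sum_(x in U :|: W)
     face_coef (U :|: W) x *: g ((U :|: W) :\ x)
  = \sum_(x in U) face_coef U x *: (prod_coef (U :\ x) W *: g (U :\ x :|: W))
    + (-1) ^+ #|U| *: \sum_(x in W)
        face_coef W x *: (prod_coef U (W :\ x) *: g (U :|: W :\ x)).
Proof.
move=> sU sW; case: (boolP [disjoint U & W]) => dUW.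
  rewrite (eq_bigl [predU U & W]) => [|x]; last by rewrite inE.
  rewrite bigU //= scalerDr !scaler_sumr; congr (_ + _); apply: eq_bigr => x xA.
    rewrite !scalerA face_prodl // setDUl; congr (_ *: g (_ :|: _)).
    by apply/setDidPl; rewrite disjoint_sym disjoints1 (disjointFr dUW).
  rewrite !scalerA face_prodr // setDUl; congr (_ *: g (_ :|: _)).
  by apply/setDidPl; rewrite disjoint_sym disjoints1 (disjointFl dUW).
rewrite {1}/prod_coef (negPf dUW) scale0r.
(* A term deleting an element other than the common z still has z in both factors and vanishes; the
   two terms deleting z cancel. *)
case/pred0Pn: dUW => z /andP[/= zU zW].
have nz (A B : {set I}) : z \in A -> z \in B -> prod_coef A B = 0.
  by move=> zA zB; rewrite /prod_coef; case: ifP => // d; rewrite (disjointFr d zA) in zB.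
rewrite (bigD1 z) //= big1 ?addr0 => [|x /andP[xU xz]]; last first.
  by rewrite nz // ?scale0r ?scaler0 // in_setD1 eq_sym xz.
rewrite (bigD1 z) //= big1 ?addr0 => [|x /andP[xU xz]]; last first.
  by rewrite nz // ?scale0r ?scaler0 // in_setD1 eq_sym xz.
rewrite !scalerA face_prod_cancel // scaleNr.
have -> : U :\ z :|: W = U :|: W :\ z; last by rewrite addNr.
apply/setP => x; rewrite !inE; case: eqVneq => [->|//]; first by rewrite zU zW.
Qed.

(** Both sides vanish unless the three sets are pairwise disjoint. Then inversions add up, and both
    exponents are the sum of the three lcms minus the lcm of the union. *)
Lemma prod_coefA U W Z :
  prod_coef U W * prod_coef (U :|: W) Z = prod_coef W Z * prod_coef U (W :|: Z).
Proof.
have Ed1 : [disjoint U :|: W & Z] = [disjoint U & Z] && [disjoint W & Z].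
  by rewrite -!setI_eq0 setIUl setU_eq0.
have Ed2 : [disjoint U & W :|: Z] = [disjoint U & W] && [disjoint U & Z].
  by rewrite -!setI_eq0 setIUr setU_eq0.
rewrite /prod_coef Ed1 Ed2 -setUA.
case: (boolP [disjoint U & W]) => d1; last by rewrite mul0r !andFb mulr0.
case: (boolP [disjoint W & Z]) => d2; last by rewrite mul0r andbF mulr0.
rewrite andTb andbT; case: ifP => d3; last by rewrite !mulr0.
rewrite [LHS]mulrACA [RHS]mulrACA -!exprD -!mpolyXD tsignUl // tsignUr //.
rewrite [X in _ ^+ X]addnCA [X in _ = _ ^+ X * _]addnA; congr (_ ^+ _ * 'X_[_]).
  lia.
by apply/mnmP => j; rewrite !(mnmDE, mnmBE) !lcm_setU; lia.
Qed.

End TaylorCoefficients.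

(** * From identities of coefficients to the dg algebra axioms *)

Section TaylorAlgebra.
Variables (k : fieldType) (N : nat) (I : finType) (S : {set I}) (lt : rel I).
Variable u : I -> 'X_{1..N}.
Hypothesis ltS : strict_total_order S lt.
Implicit Types U W Z : {set I}.
Notation Q := {mpoly k[N]}.
Notation T := (taylor k S lt u).
Notation tmul := (taylor_mul k N I S lt u).

Lemma cellP i (U : cell S i) : (val U \subset S) /\ #|val U| = i.
Proof. by case/andP: (valP U) => -> /eqP ->. Qed.

Lemma tgenE i (U U' : cell S i) :
  (tgen S i (val U) : taylor_obj k N S i) U' = (U == U')%:R.
Proof. by rewrite ffunE eq_sym. Qed.

Lemma taylor_sum i (f : taylor_obj k N S i) :
  f = \sum_(U : cell S i) f U *: tgen S i (val U).
Proof.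
apply/ffunP => U; rewrite sum_ffunE (bigD1 U) //= big1 ?addr0 => [|W WU].
  by rewrite ffunE tgenE eqxx /GRing.scale /= mulr1.
by rewrite ffunE tgenE (negPf WU) /GRing.scale /= mulr0.
Qed.

Lemma taylor_ext (M : lmodType Q) i (f g : taylor_obj k N S i -> M) :
  linear f -> linear g ->
  (forall U, U \subset S -> #|U| = i -> f (tgen S i U) = g (tgen S i U)) ->
  forall x, f x = g x.
Proof.
move=> hf hg fg x; rewrite (taylor_sum x) (linear_sum_of hf) (linear_sum_of hg).
apply: eq_bigr => U _; rewrite (linearZ_of hf) (linearZ_of hg).
by congr (_ *: _); case: (cellP U); apply: fg.
Qed.

Lemma tgen_dif i U : U \subset S -> #|U| = i.+1 ->
  dif T i (tgen S i.+1 U) =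
  \sum_(x in U) face_coef k lt u U x *: (tgen S i (U :\ x) : T i).
Proof.
move=> sU cU; have hU : (U \subset S) && (#|U| == i.+1) by rewrite sU cU eqxx.
apply/ffunP => V; rewrite sum_ffunE ffunE (bigD1 (Sub U hU : cell S i.+1)) //=.
rewrite [X in _ + X]big1 ?addr0 => [|W WU]; last first.
  have -> : tgen S i.+1 U = tgen S i.+1 (val (Sub U hU : cell S i.+1)) by [].
  by rewrite tgenE eq_sym (negPf WU) mul0r.
rewrite ffunE eqxx mul1r /taylor_dcoef big_mkcondr /=; apply: eq_bigr => x xU.
rewrite !ffunE /GRing.scale /=; case: ifP => _; rewrite ?mulr1 ?mulr0 //.
Qed.

Lemma taylor_mul_linearl i j l (e : (i + j)%N = l) (b : T j) :
  linear (fun a : T i => tmul i j l e a b).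
Proof.
move=> q x y; apply/ffunP => V; rewrite !ffunE /GRing.scale /= mulr_sumr.
rewrite -big_split; apply: eq_bigr => U _ /=.
rewrite mulr_sumr -big_split; apply: eq_bigr => W _ /=.
by rewrite !ffunE /GRing.scale /= !mulrDl !mulrA.
Qed.

Lemma taylor_mul_linearr i j l (e : (i + j)%N = l) (a : T i) :
  linear (fun b : T j => tmul i j l e a b).
Proof.
move=> q x y; apply/ffunP => V; rewrite !ffunE /GRing.scale /= mulr_sumr.
rewrite -big_split; apply: eq_bigr => U _ /=.
rewrite mulr_sumr -big_split; apply: eq_bigr => W _ /=.
rewrite !ffunE /GRing.scale /= !mulrDr !mulrDl !mulrA.
by rewrite [_ U * q]mulrC.
Qed.

Lemma mul_tgen i j l (e : (i + j)%N = l) U W :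
  U \subset S -> #|U| = i -> W \subset S -> #|W| = j ->
  tmul i j l e (tgen S i U) (tgen S j W) =
  prod_coef k lt u U W *: (tgen S l (U :|: W) : T l).
Proof.
move=> sU cU sW cW.
have hU : (U \subset S) && (#|U| == i) by rewrite sU cU eqxx.
have hW : (W \subset S) && (#|W| == j) by rewrite sW cW eqxx.
pose U' : cell S i := Sub U hU; pose W' : cell S j := Sub W hW.
apply/ffunP => V; rewrite ffunE (bigD1 U') //= [X in _ + X]big1 ?addr0; last first.
  move=> Z ZU; rewrite big1 // => Y _.
  have -> : tgen S i U = tgen S i (val U') by [].
  by rewrite tgenE eq_sym (negPf ZU) !mul0r.
rewrite (bigD1 W') //= [X in _ + X]big1 ?addr0; last first.
  move=> Z ZW; have -> : tgen S j W = tgen S j (val W') by [].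
  by rewrite [X in _ * X * _]tgenE eq_sym (negPf ZW) mulr0 mul0r.
rewrite !ffunE !eqxx !mul1r /taylor_mcoef /prod_coef /GRing.scale /=.
case: [disjoint _ & _]; rewrite /= ?mul0r //.
by case: (_ == _); rewrite ?mulr1 ?mulr0.
Qed.


Lemma taylor_ext2 (M : lmodType Q) i j
    (f g : taylor_obj k N S i -> taylor_obj k N S j -> M) :
  (forall b, linear (f^~ b)) -> (forall a, linear (f a)) ->
  (forall b, linear (g^~ b)) -> (forall a, linear (g a)) ->
  (forall U W, U \subset S -> #|U| = i -> W \subset S -> #|W| = j ->
     f (tgen S i U) (tgen S j W) = g (tgen S i U) (tgen S j W)) ->
  forall x y, f x y = g x y.
Proof.
move=> fl fr gl gr fg x y.
apply: (taylor_ext (f := f^~ y) (g := g^~ y)) => // U sU cU.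
by apply: taylor_ext => // W sW cW; apply: fg.
Qed.

Lemma taylor_complex : is_complex T.
Proof.
(* The claim is put as an equality of two linear functions of [a], to be checked on generators. *)
move=> i a; pose dd (a : taylor_obj k N S i.+2) : T i := dif T i (dif T i.+1 a).
suff : dd a = (fun=> 0) a by [].
move: a; apply: taylor_ext; rewrite ?/dd.
- by move=> q x y; rewrite !linearP.
- by move=> q x y; rewrite scaler0 addr0.
move=> U sU cU; rewrite tgen_dif // dif_sum.
rewrite -[RHS](face_sum_sq0 u ltS (fun V => tgen S i V : T i) sU).
apply: eq_bigr => x xU; rewrite difZ tgen_dif ?(subset_trans (subD1set _ _)) //.
by move: cU; rewrite (cardsD1 x) xU add1n => -[].
Qed.

Lemma taylor0E (a : T 0%N) : a = taylor0 a *: taylor_one k S lt u.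
Proof.
rewrite [LHS]taylor_sum /taylor0 scaler_suml; apply: eq_bigr => U _.
by case: (cellP U) => _ /cards0_eq ->.
Qed.

Lemma taylor0_one : taylor0 (taylor_one k S lt u) = 1.
Proof.
have h0 : (set0 \subset S) && (#|set0 : {set I}| == 0%N) by rewrite sub0set cards0.
pose U0 : cell S 0 := Sub set0 h0.
rewrite /taylor0 (bigD1 U0) //= big1 ?addr0 => [|U UU].
  by rewrite ffunE eqxx.
case: (cellP U) => _ /cards0_eq E0; case/eqP: UU; exact: val_inj.
Qed.

Lemma taylor0_linear : linear (fun a : T 0%N => taylor0 a : Q^o).
Proof.
move=> q a b; rewrite /taylor0 scaler_sumr -big_split; apply: eq_bigr => U _.
by rewrite !ffunE.
Qed.

Lemma card_prod_coef U W i j l : #|U| = i -> #|W| = j -> (i + j)%N = l ->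
  prod_coef k lt u U W != 0 -> #|U :|: W| = l.
Proof.
rewrite /prod_coef => <- <- <-; case: ifP; rewrite ?eqxx // => d _.
by rewrite cardsU (disjoint_setI0 d) cards0 subn0.
Qed.

(* The cardinality of U is only required when p is nonzero: in the application p
   is a prod_coef, which vanishes exactly when U is a non-disjoint union. *)
Lemma mulZ_tgenl i j l (e : (i + j)%N = l) (p : Q) U W :
  U \subset S -> (p != 0 -> #|U| = i) -> W \subset S -> #|W| = j ->
  tmul i j l e (p *: (tgen S i U : T i)) (tgen S j W) =
  (p * prod_coef k lt u U W) *: (tgen S l (U :|: W) : T l).
Proof.
move=> sU cU sW cW; rewrite (linearZ_of (taylor_mul_linearl e _)).
have [->|p0] := eqVneq p 0; first by rewrite mul0r !scale0r.
by rewrite (mul_tgen e sU (cU p0) sW cW) scalerA.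
Qed.

Lemma mulZ_tgenr i j l (e : (i + j)%N = l) (p : Q) U W :
  U \subset S -> #|U| = i -> W \subset S -> (p != 0 -> #|W| = j) ->
  tmul i j l e (tgen S i U) (p *: (tgen S j W : T j)) =
  (p * prod_coef k lt u U W) *: (tgen S l (U :|: W) : T l).
Proof.
move=> sU cU sW cW; rewrite (linearZ_of (taylor_mul_linearr e _)).
have [->|p0] := eqVneq p 0; first by rewrite mul0r !scale0r.
by rewrite (mul_tgen e sU cU sW (cW p0)) scalerA.
Qed.

Lemma taylor_mulA i j l ij jl m (e1 : (i + j)%N = ij) (e2 : (ij + l)%N = m)
    (e3 : (j + l)%N = jl) (e4 : (i + jl)%N = m) (a : T i) (b : T j) (c : T l) :
  tmul ij l m e2 (tmul i j ij e1 a b) c = tmul i jl m e4 a (tmul j l jl e3 b c).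
Proof.
move: a b; apply: taylor_ext2.
- by move=> b q x y; rewrite !taylor_mul_linearl.
- by move=> a q x y; rewrite taylor_mul_linearr taylor_mul_linearl.
- by move=> b q x y; rewrite !taylor_mul_linearl.
- by move=> a q x y; rewrite taylor_mul_linearl taylor_mul_linearr.
move=> U W sU cU sW cW; move: c; apply: taylor_ext.
- by move=> q x y; rewrite !taylor_mul_linearr.
- by move=> q x y; rewrite !taylor_mul_linearr.
move=> Z sZ cZ; rewrite (mul_tgen e1 sU cU sW cW) (mul_tgen e3 sW cW sZ cZ).
have sUW : U :|: W \subset S by rewrite subUset sU sW.
have sWZ : W :|: Z \subset S by rewrite subUset sW sZ.
rewrite (mulZ_tgenl _ sUW (card_prod_coef cU cW e1) sZ cZ).
rewrite (mulZ_tgenr _ sU cU sWZ (card_prod_coef cW cZ e3)).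
by rewrite prod_coefA setUA.
Qed.

Lemma taylor_mul1l j (e : (0 + j)%N = j) (b : T j) :
  tmul 0%N j j e (taylor_one k S lt u) b = b.
Proof.
move: b; apply: taylor_ext => [|q x y //|U sU cU].
  by move=> q x y; rewrite taylor_mul_linearr.
rewrite /taylor_one mul_tgen ?sub0set ?cards0 // set0U /prod_coef.
rewrite -setI_eq0 set0I eqxx tsignE big_set0 lcm_set0 add0m set0U.
have -> : (lcm_set u U - lcm_set u U = 0)%MM.
  by apply/mnmP => x; rewrite mnmBE mnm0E subnn.
by rewrite mpolyX0 mulr1 scale1r.
Qed.

Lemma taylor_mulC i j l (e : (i + j)%N = l) (e' : (j + i)%N = l)
    (a : T i) (b : T j) :
  tmul i j l e a b = (-1) ^+ (i * j)%N *: tmul j i l e' b a.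
Proof.
move: a b; apply: taylor_ext2.
- by move=> b q x y; rewrite taylor_mul_linearl.
- by move=> a q x y; rewrite taylor_mul_linearr.
- by move=> b q x y; rewrite taylor_mul_linearr scalerDr !scalerA mulrC.
- by move=> a q x y; rewrite taylor_mul_linearl scalerDr !scalerA mulrC.
move=> U W sU cU sW cW; rewrite (mul_tgen e sU cU sW cW) (mul_tgen e' sW cW sU cU) scalerA.
by rewrite [W :|: U]setUC (prod_coefC k u ltS sU sW) cU cW.
Qed.

(** Off the diagonal, terms cancel in pairs by graded commutativity. A diagonal term vanishes
    because a set of odd cardinality is nonempty, hence not disjoint from itself. *)
Lemma taylor_mul_square i l (e : (i + i)%N = l) (a : T i) :
  odd i -> tmul i i l e a a = 0.
Proof.
move=> oi; apply/ffunP => V; rewrite !ffunE.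
have E (U W : cell S i) :
    taylor_mcoef k lt u (val U) (val W) (val V)
    = if val V == val U :|: val W then prod_coef k lt u (val U) (val W) else 0.
  by rewrite /taylor_mcoef /prod_coef; case: [disjoint _ & _]; case: (_ == _).
apply: alternating_sum => [U|U W]; rewrite !E.
  rewrite /prod_coef -setI_eq0 setIid -cards_eq0; case: (cellP U) => _ ->.
  by have /negPf -> : i != 0%N; [case: (i) oi | rewrite if_same mulr0].
rewrite setUC; case: ifP => _; last by rewrite !mulr0 oppr0.
case: (cellP U) (cellP W) => sU cU [sW cW].
rewrite (prod_coefC _ _ ltS sU sW) cU cW -signr_odd oddM oi mulN1r mulrN.
by rewrite [a U * a W]mulrC.
Qed.

Lemma taylor_leibniz i j l (e : (i.+1 + j.+1)%N = l.+1)
    (e1 : (i + j.+1)%N = l) (e2 : (i.+1 + j)%N = l) (a : T i.+1) (b : T j.+1) :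
  dif T l (tmul i.+1 j.+1 l.+1 e a b)
  = tmul i j.+1 l e1 (dif T i a) b
    + (-1) ^+ i.+1 *: tmul i.+1 j l e2 a (dif T j b).
Proof.
move: a b; apply: taylor_ext2.
- by move=> b q x y; rewrite taylor_mul_linearl dif_linear.
- by move=> a q x y; rewrite taylor_mul_linearr dif_linear.
- move=> b q x y; rewrite dif_linear !taylor_mul_linearl.
  by rewrite !scalerDr !scalerA [q * _]mulrC addrACA.
- move=> a q x y; rewrite dif_linear !taylor_mul_linearr.
  by rewrite !scalerDr !scalerA [q * _]mulrC addrACA.
move=> U W sU cU sW cW; rewrite (mul_tgen e sU cU sW cW) difZ.
(* [tgen_dif] needs the union to have l + 1 elements, which holds when the coefficient is
   nonzero. *)
have -> : prod_coef k lt u U W *: dif T l (tgen S l.+1 (U :|: W))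
   = prod_coef k lt u U W *: \sum_(x in U :|: W) face_coef k lt u (U :|: W) x
        *: (tgen S l ((U :|: W) :\ x) : T l).
  have [->|p0] := eqVneq (prod_coef k lt u U W) 0; first by rewrite !scale0r.
  rewrite tgen_dif ?subUset ?sU ?sW //; exact: (card_prod_coef cU cW e).
rewrite (face_prod_leibniz u ltS (fun V => tgen S l V : T l) sU sW) cU.
rewrite (tgen_dif sU cU) (tgen_dif sW cW) (linear_sum_of (taylor_mul_linearl e1 _)).
rewrite (linear_sum_of (taylor_mul_linearr e2 _)).
have cD1 (V : {set I}) p x : #|V| = p.+1 -> x \in V -> #|V :\ x| = p.
  by move=> cV xV; move: cV; rewrite (cardsD1 x V) xV => -[].
congr (_ + _ *: _); apply: eq_bigr => x xV.
  rewrite (linearZ_of (taylor_mul_linearl e1 _)).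
  by rewrite (mul_tgen e1 (subset_trans (subD1set _ _) sU) (cD1 U i x cU xV) sW cW).
rewrite (linearZ_of (taylor_mul_linearr e2 _)).
by rewrite (mul_tgen e2 sU cU (subset_trans (subD1set _ _) sW) (cD1 W j x cW xV)).
Qed.

Lemma taylor_mul1r i (e : (i + 0)%N = i) (a : T i) :
  tmul i 0%N i e a (taylor_one k S lt u) = a.
Proof. by rewrite (taylor_mulC e (add0n i)) muln0 scale1r taylor_mul1l. Qed.

Lemma taylor_degree0 (a : T 0%N) : exists! q : Q, a = q *: taylor_one k S lt u.
Proof.
exists (taylor0 a); split; first exact: taylor0E.
move=> q ->; rewrite (linearZ_of taylor0_linear) taylor0_one.
exact: mulr1.
Qed.

Lemma taylor_dg_algebra : dg_algebra (taylor_one k S lt u) tmul.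
Proof.
split.
- exact: taylor_complex.
- exact: taylor_mul_linearl.
- exact: taylor_mul_linearr.
- exact: taylor_mul1l.
- exact: taylor_mul1r.
- exact: taylor_mulA.
- exact: taylor_degree0.
- exact: taylor_leibniz.
- move=> j l e e' a b; rewrite (taylor0E a).
  rewrite !(linearZ_of (taylor_mul_linearl _ _)) difZ.
  by case: _ / e' e b => e b; rewrite !taylor_mul1l.
- move=> i l e e' a b; rewrite (taylor0E b).
  rewrite !(linearZ_of (taylor_mul_linearr _ _)) difZ.
  have ei : i = l by rewrite -e' addn0.
  by case: _ / ei e' e => e' e; rewrite !taylor_mul1r.
Qed.

Lemma taylor_strictly_commutative : strictly_commutative tmul.
Proof.
by split=> *; [exact: taylor_mulC | exact: taylor_mul_square].
Qed.

End TaylorAlgebra.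

(** * Exactness of the Koszul complex *)

Section VariableQuotient.
Variables (k : fieldType) (N : nat).
Implicit Types (p q : {mpoly k[N]}) (v : 'I_N) (m : 'X_{1..N}).

(* The quotient of p by X_v, dropping the monomials in which X_v does not
   occur. *)
Definition var_quot v p : {mpoly k[N]} :=
  \sum_(m <- msupp p | (0 < m v)%N) p@_m *: 'X_[(m - U_(v))%MM].

Lemma mcoeff_var_quot v p m : (var_quot v p)@_m = p@_(m + U_(v)).
Proof.
rewrite /var_quot raddf_sum /=.
have inj m' : (0 < m' v)%N -> ((m' - U_(v))%MM == m) = (m' == m + U_(v))%MM.
  move=> m'v; have le : (U_(v) <= m')%MM by rewrite lep1mP -lt0n.
  by apply/eqP/eqP => [<-|->]; [rewrite submK | rewrite addmK].
have [|] := boolP ((m + U_(v))%MM \in msupp p); last first.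
  move=> h; rewrite (memN_msupp_eq0 h) big1_seq // => m' /andP[m'v m'p].
  rewrite mcoeffZ mcoeffX inj //; case: eqP m'p => [->|_ _]; last by rewrite mulr0.
  by rewrite (negPf h).
move=> h; rewrite big_mkcond (bigD1_seq (m + U_(v))%MM) ?msupp_uniq //=.
have mv : (0 < (m + U_(v))%MM v)%N by rewrite mnmDE mnm1E eqxx addn1.
rewrite mv mcoeffZ mcoeffX inj ?eqxx ?mulr1 // big1 ?addr0 // => m' ne.
case: ifP => // m'v.
by rewrite mcoeffZ mcoeffX inj // (negPf ne) mulr0.
Qed.

Lemma var_quot_is_zmod_morphism v : zmod_morphism (var_quot v).
Proof.
by move=> p q; apply/mpolyP => m; rewrite mcoeffB !mcoeff_var_quot mcoeffB.
Qed.

HB.instance Definition _ v :=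
  GRing.isZmodMorphism.Build {mpoly k[N]} {mpoly k[N]} (var_quot v)
    (var_quot_is_zmod_morphism v).

Lemma var_quotXv v p : var_quot v ('X_v * p) = p.
Proof.
by apply/mpolyP => m; rewrite mcoeff_var_quot mulrC addmC mcoeffMX.
Qed.

Lemma mcoeffMX_eq0 p m m' : ~~ (m <= m')%MM -> (p * 'X_[m])@_m' = 0.
Proof.
move=> h; apply: memN_msupp_eq0; rewrite (perm_mem (msuppMX _ _)).
by apply: contra h => /mapP[m0 _ ->]; exact: lem_addr.
Qed.

Lemma var_quotMX v m p : m v = 0%N ->
  var_quot v ('X_[m] * p) = 'X_[m] * var_quot v p.
Proof.
move=> mv; apply/mpolyP => c; rewrite mcoeff_var_quot ![_ * p]mulrC ['X_[m] * _]mulrC.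
have le : (m <= c + U_(v))%MM = (m <= c)%MM.
  apply/mnm_lepP/mnm_lepP => h i; have := h i; rewrite mnmDE mnm1E; last by lia.
  by case: eqVneq => [<-|_]; rewrite ?mv // addn0.
case: (boolP (m <= c)%MM) => h; last by rewrite !mcoeffMX_eq0 ?le.
have -> : c = (m + (c - m))%MM by rewrite addmC submK.
by rewrite -addmA !mcoeffMX mcoeff_var_quot.
Qed.

Lemma mulXv_inj v : injective ( *%R ('X_v : {mpoly k[N]}) ).
Proof. exact: can_inj (var_quotXv v). Qed.

End VariableQuotient.

(** * Homotopies of the Koszul complex, one variable at a time *)

Section KoszulExact.
Variables (k : fieldType) (N : nat) (I : finType) (S : {set I}) (lt : rel I).
Variable p : I -> 'I_N.
Hypotheses (ltS : strict_total_order S lt) (p_inj : injective p).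
Implicit Types U W : {set I}.
Notation Q := {mpoly k[N]}.
Notation var := (fun x => U_(p x)%MM : 'X_{1..N}).
Notation K := (taylor k S lt var).

Lemma lcm_varE U j : lcm_set var U j = (j \in p @: U).
Proof.
rewrite lcm_setE; apply/eqP; rewrite eqn_leq; apply/andP; split.
  by apply/bigmax_leqP => x xU; rewrite mnm1E; case: eqVneq => // <-; rewrite imset_f.
case: imsetP => // -[x xU ->]; apply: (leq_trans _ (leq_bigmax_cond _ xU)).
by rewrite mnm1E eqxx.
Qed.

Lemma lcm_var_face U x : x \in U ->
  (lcm_set var U - lcm_set var (U :\ x) = U_(p x))%MM.
Proof.
move=> xU; apply/mnmP => j; rewrite mnmBE !lcm_varE mnm1E.
case: eqVneq => [<-|pxj].
  rewrite imset_f // (_ : (p x \in _) = false) //.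
  by apply/negP => /imsetP[y /setD1P[yx _] /p_inj xy]; rewrite xy eqxx in yx.
rewrite (_ : (j \in p @: (U :\ x)) = (j \in p @: U)) ?subnn //.
apply/imsetP/imsetP => -[y yU jE]; exists y => //; first by case/setD1P: yU.
by rewrite in_setD1 yU andbT; apply: contra_neq pxj => <-.
Qed.

Lemma koszul_face_coef U x : x \in U ->
  face_coef k lt var U x = (-1) ^+ tsign lt [set x] U * 'X_(p x).
Proof. by move=> xU; rewrite /face_coef lcm_var_face. Qed.

(* Additive, but linear only over the polynomials not involving X_(p v). *)
Definition koszul_homotopy v i (f : taylor_obj k N S i) : K i.+1 :=
  \sum_(U : cell S i | v \notin val U)
     ((-1) ^+ tsign lt [set v] (v |: val U) * var_quot (p v) (f U))
       *: (tgen S i.+1 (v |: val U) : K i.+1).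

Lemma koszul_homotopyB v i (f g : K i) :
  koszul_homotopy v (f - g) = koszul_homotopy v f - koszul_homotopy v g.
Proof.
rewrite /koszul_homotopy -sumrB; apply: eq_bigr => U _.
by rewrite !ffunE raddfB mulrBr scalerBl.
Qed.

Lemma koszul_homotopy_tgen v i q U : U \subset S -> #|U| = i ->
  koszul_homotopy v (q *: (tgen S i U : K i)) =
  (if v \in U then 0
   else (-1) ^+ tsign lt [set v] (v |: U) * var_quot (p v) q)
    *: (tgen S i.+1 (v |: U) : K i.+1).
Proof.
move=> sU cU; have hU : (U \subset S) && (#|U| == i) by rewrite sU cU eqxx.
pose U' : cell S i := Sub U hU.
rewrite /koszul_homotopy big_mkcond (bigD1 U') //= [X in _ + X]big1 ?addr0; last first.
  move=> W WU; case: ifP => // _; rewrite ffunE.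
  have -> : tgen S i U = tgen S i (val U') by [].
  rewrite tgenE eq_sym (negPf WU).
  by rewrite mulr0n scaler0 raddf0 mulr0 scale0r.
case: (boolP (v \in U)) => vU; first by rewrite scale0r.
by rewrite !ffunE eqxx (mulr1 q : q *: (1 : Q^o) = q).
Qed.

(** The homotopies are additive but not linear over Q, so equality is tested on all multiples of the
    generators. *)
Lemma taylor_ext_additive (V : zmodType) i (f g : taylor_obj k N S i -> V) :
  zmod_morphism f -> zmod_morphism g ->
  (forall q U, U \subset S -> #|U| = i ->
     f (q *: (tgen S i U : K i)) = g (q *: (tgen S i U : K i))) ->
  forall x, f x = g x.
Proof.
move=> hf hg fg x; rewrite (taylor_sum x).
pose F : {additive taylor_obj k N S i -> V} :=
  HB.pack f (GRing.isZmodMorphism.Build _ _ f hf).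
pose G : {additive taylor_obj k N S i -> V} :=
  HB.pack g (GRing.isZmodMorphism.Build _ _ g hg).
rewrite [LHS](raddf_sum F) [RHS](raddf_sum G).
by apply: eq_bigr => U _; case: (cellP U); apply: fg.
Qed.

(** Multiplying [var_quot (p v) q] by ['X_(p v)] gives q without its monomials free of that
    variable. So this is the identity minus the projection onto elements that involve neither v nor
    its variable. *)
Definition koszul_free_part v i (f : taylor_obj k N S i) : taylor_obj k N S i :=
  [ffun U : cell S i =>
     if v \in val U then f U else 'X_(p v) * var_quot (p v) (f U)].

Lemma koszul_free_part_tgen v i q U :
  koszul_free_part v (q *: tgen S i U) =
  (if v \in U then q else 'X_(p v) * var_quot (p v) q) *: tgen S i U.
Proof.
have scaleE (a : Q) (W : cell S i) :
    (a *: tgen S i U : taylor_obj k N S i) W = a * (val W == U)%:R.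
  by rewrite ffunE ffunE.
apply/ffunP => W; apply: etrans (ffunE _ W) _.
apply: etrans (esym (scaleE _ W)).
apply: etrans (congr1 (fun c => if v \in val W then c
                                else 'X_(p v) * var_quot (p v) c) (scaleE q W)) _.
case: eqVneq => [->|_]; first by rewrite !mulr1.
by rewrite !mulr0 raddf0 mulr0 if_same.
Qed.

(** If v is in U, the homotopy sees only the face deleting v and returns q there. If not, the face
    of [v |: U] deleting v gives the right-hand side, and the other faces cancel against the second
    sum by [odd_tsign_swap]. *)
Lemma koszul_homotopy_identity (V : lmodType Q) (g : {set I} -> V) v q U :
  v \in S -> U \subset S ->
  (if v \in U then 0
   else (-1) ^+ tsign lt [set v] (v |: U) * var_quot (p v) q)
    *: \sum_(y in v |: U) face_coef k lt var (v |: U) y *: g ((v |: U) :\ y)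
  + \sum_(y in U) (if v \in U :\ y then 0
      else (-1) ^+ tsign lt [set v] (v |: U :\ y)
           * var_quot (p v) (q * face_coef k lt var U y)) *: g (v |: U :\ y)
  = (if v \in U then q else 'X_(p v) * var_quot (p v) q) *: g U.
Proof.
move=> vS sU; case: (boolP (v \in U)) => vU.
  rewrite scale0r add0r (bigD1 v) //= big1 ?addr0 => [|y /andP[yU yv]]; last first.
    by rewrite in_setD1 eq_sym yv vU scale0r.
  rewrite in_setD1 eqxx /= setD1K // koszul_face_coef // mulrCA raddfMsign.
  by rewrite signrMK /= [q * _]mulrC var_quotXv.
rewrite big_setU1 //= scalerDr scalerA setU1K //.
rewrite koszul_face_coef ?setU11 // mulrACA -expr2 sqrr_sign mul1r.
rewrite [var_quot _ _ * _]mulrC -addrA -[RHS]addr0; congr (_ + _).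
rewrite scaler_sumr -big_split big1 //= => y yU.
have yv : v != y by apply: contraNneq vU => ->.
rewrite in_setD1 (negPf vU) andbF !koszul_face_coef ?setU1r //.
have -> : (v |: U) :\ y = v |: U :\ y.
  rewrite setDUl; congr (_ :|: _); apply/setDidPl.
  by rewrite disjoints1 in_set1.
rewrite scalerA -scalerDl [X in X *: _](_ : _ = 0) ?scale0r //.
rewrite [q * _]mulrCA raddfMsign /= [q * _]mulrC var_quotMX; last first.
  by rewrite mnm1E (inj_eq p_inj) eq_sym (negPf yv).
have sgn : (-1) ^+ tsign lt [set v] (v |: U) * (-1) ^+ tsign lt [set y] (v |: U)
    = - ((-1) ^+ tsign lt [set v] (v |: U :\ y) * (-1) ^+ tsign lt [set y] U) :> Q.
  rewrite -!exprD; apply: signr_neq.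
  have sU' : v |: U \subset S by rewrite subUset sub1set vS sU.
  have := odd_tsign_swap ltS sU' (setU11 v U) (setU1r v yU) yv.
  rewrite setU1K // (_ : (v |: U) :\ y = v |: U :\ y); first lia.
  rewrite setDUl; congr (_ :|: _); apply/setDidPl.
  by rewrite disjoints1 in_set1.
by rewrite mulrACA sgn mulNr [_ * (_ * (_ * _))]mulrA ['X_(p y) * _]mulrC addNr.
Qed.

Lemma koszul_homotopyP v i (x : K i.+1) : v \in S ->
  dif K i.+1 (koszul_homotopy v x) + koszul_homotopy v (dif K i x)
  = koszul_free_part v x.
Proof.
move=> vS; pose F (x : K i.+1) : K i.+1 :=
  dif K i.+1 (koszul_homotopy v x) + koszul_homotopy v (dif K i x).
rewrite -/(F x); move: x; apply: taylor_ext_additive.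
- move=> x y; rewrite /F koszul_homotopyB !difD !difN koszul_homotopyB.
  by rewrite opprD addrACA.
- move=> x y; apply/ffunP => U; rewrite !ffunE; case: ifP => // _.
  by rewrite raddfB mulrBr.
move=> q U sU cU; rewrite /F koszul_free_part_tgen (koszul_homotopy_tgen v q sU cU).
have hsub (A : {set I}) y : A \subset S -> A :\ y \subset S.
  by move=> sA; rewrite (subset_trans (subD1set _ _)).
have cD1 y : y \in U -> #|U :\ y| = i.
  by move=> yU; move: cU; rewrite (cardsD1 y U) yU => -[].
have hsum (r : seq I) P (G : I -> K i) :
    koszul_homotopy v (\sum_(y <- r | P y) G y)
    = \sum_(y <- r | P y) koszul_homotopy v (G y).
  pose H : {additive K i -> K i.+1} :=
    HB.pack (@koszul_homotopy v i)
      (GRing.isZmodMorphism.Build (K i) (K i.+1) (@koszul_homotopy v i)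
         (@koszul_homotopyB v i)).
  exact: (raddf_sum H).
apply: etrans _
  (koszul_homotopy_identity (fun W => tgen S i.+1 W : K i.+1) q vS sU).
congr (_ + _).
  rewrite difZ; case: (boolP (v \in U)) => vU; first by rewrite !scale0r.
  have sU' : v |: U \subset S by rewrite subUset sub1set vS sU.
  have cU' : #|v |: U| = i.+2 by rewrite cardsU1 vU cU.
  by rewrite (tgen_dif _ _ _ sU' cU').
rewrite [dif K i _]difZ (tgen_dif _ _ _ sU cU) scaler_sumr hsum.
apply: eq_bigr => y yU; rewrite scalerA.
exact: (koszul_homotopy_tgen _ _ (hsub _ _ sU) (cD1 _ yU)).
Qed.

(* Subtracting from a cycle x the boundary of its homotopy at v kills the
   coordinates at the sets containing v and keeps the zero coordinates zero, so
   that the elements of S can be treated one after the other. *)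
Lemma koszul_cycle_reduction i (x : taylor_obj k N S i.+1) (s : seq I) :
  {subset s <= S} -> dif K i x = 0 ->
  exists y : K i.+2, forall U : cell S i.+1,
    has (mem (val U)) s -> (x - dif K i.+1 y : taylor_obj k N S i.+1) U = 0.
Proof.
move=> sS dx; elim: s sS => [|v s IH] sS; first by exists 0.
have [y hy] := IH (fun w ws => sS w (@mem_behead _ (v :: s) w ws)).
have vS : v \in S by apply: sS; rewrite mem_head.
pose x' : taylor_obj k N S i.+1 := x - dif K i.+1 y.
have dx' : dif K i x' = 0.
  by rewrite difD difN dx (taylor_complex ltS) subrr.
exists (y + koszul_homotopy v x') => U.
have := koszul_homotopyP (x' : K i.+1) vS; rewrite dx'.
have h0 : koszul_homotopy v (0 : K i) = 0.
  by have := koszul_homotopyB v (0 : K i) 0; rewrite !subrr.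
rewrite h0 addr0 difD => ->; rewrite opprD addrA -/x'.
have E (f g : taylor_obj k N S i.+1) : (f - g) U = f U - g U by rewrite !ffunE.
rewrite E [X in _ - X]ffunE [has _ _]/=; case: (v \in val U) => Us.
  by rewrite subrr.
by rewrite hy // raddf0 mulr0 subr0.
Qed.

Lemma koszul_exact i (x : K i.+1) : dif K i x = 0 ->
  exists y, dif K i.+1 y = x.
Proof.
move=> dx; have sS : {subset enum S <= S} by move=> v; rewrite mem_enum.
have [y hy] := koszul_cycle_reduction sS dx.
exists y; symmetry; apply/eqP; rewrite -subr_eq0; apply/eqP.
apply/ffunP => U; rewrite hy ?ffunE //.
(* A cell of positive degree contains some element of S, so its coordinate has been killed. *)
case: (cellP U) => sU cU; have /card_gt0P[v vU] : (0 < #|val U|)%N by rewrite cU.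
by apply/hasP; exists v => //; rewrite mem_enum (subsetP sU).
Qed.

End KoszulExact.

(** * Adjoining an exterior variable to a dg algebra *)

Section Bilinear.
Variables (R : comNzRingType) (A : complex R) (one : A 0%N) (mul : products A).
Hypothesis hA : dg_algebra one mul.

Lemma dg_mulDl i j k (e : (i + j)%N = k) (x y : A i) (b : A j) :
  mul e (x + y) b = mul e x b + mul e y b.
Proof. exact: linearD_of (dga_linearl hA e b) x y. Qed.

Lemma dg_mulZl i j k (e : (i + j)%N = k) q (x : A i) (b : A j) :
  mul e (q *: x) b = q *: mul e x b.
Proof. exact: linearZ_of (dga_linearl hA e b) q x. Qed.

Lemma dg_mulNl i j k (e : (i + j)%N = k) (x : A i) (b : A j) :
  mul e (- x) b = - mul e x b.
Proof. exact: linearN_of (dga_linearl hA e b) x. Qed.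

Lemma dg_mulDr i j k (e : (i + j)%N = k) (a : A i) (x y : A j) :
  mul e a (x + y) = mul e a x + mul e a y.
Proof. exact: linearD_of (dga_linearr hA e a) x y. Qed.

Lemma dg_mulZr i j k (e : (i + j)%N = k) q (a : A i) (x : A j) :
  mul e a (q *: x) = q *: mul e a x.
Proof. exact: linearZ_of (dga_linearr hA e a) q x. Qed.

Lemma dg_mulNr i j k (e : (i + j)%N = k) (a : A i) (x : A j) :
  mul e a (- x) = - mul e a x.
Proof. exact: linearN_of (dga_linearr hA e a) x. Qed.

Lemma dg_mul_scalarl j (e : (0 + j)%N = j) q (a : A 0%N) (b : A j) :
  a = q *: one -> mul e a b = q *: b.
Proof. by move=> ->; rewrite dg_mulZl (dga_onel hA). Qed.

Lemma dg_mul_scalarr i (e : (i + 0)%N = i) q (a : A i) (b : A 0%N) :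
  b = q *: one -> mul e a b = q *: a.
Proof. by move=> ->; rewrite dg_mulZr (dga_oner hA). Qed.

(** All terms but the first carry the factor q. Hence, for a multiplicative map f, the elements f a
    + q b are closed under products. *)
Lemma dg_mul_perturb i j k (e : (i + j)%N = k) q (a b : A i) (a' b' : A j) :
  mul e (a + q *: b) (a' + q *: b')
  = mul e a a' + q *: (mul e a b' + mul e b a' + q *: mul e b b').
Proof.
by rewrite !(dg_mulDl, dg_mulDr, dg_mulZl, dg_mulZr) !scalerDr -!addrA.
Qed.

End Bilinear.

Lemma cone_is_complex (R : comNzRingType) (A M : complex R) (beta : gmap M A) :
  is_complex A -> is_complex M -> chain_map beta -> is_complex (cone beta).
Proof.
move=> hA hM hb [|i] [a m].
  by rewrite /= difD hA add0r -hb raddfN subrr.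
by rewrite /= difD difN hA hM oppr0 add0r raddfN /= -hb subrr oppr0.
Qed.

Lemma pair_ext (S T : Type) (x y : S * T) : x.1 = y.1 -> x.2 = y.2 -> x = y.
Proof. by case: x y => a b [c d] /= -> ->. Qed.

Section ScalarCone.
Variables (R : comNzRingType) (A : complex R) (r : R).

Lemma scale_linear i : linear (fun x : A i => r *: x).
Proof. by move=> q x y; rewrite scalerDr !scalerA mulrC. Qed.

Definition scale_gmap : gmap A A := fun i => mklin (@scale_linear i).

Variables (one : A 0%N) (mul : products A).
Hypotheses (hA : dg_algebra one mul) (hC : strictly_commutative mul).

Notation P := (cone scale_gmap).

(** Degree equations for the second components, whose degree is one less than that of the
    element. *)
Lemma succ_add_pred i j k : (i.+1 + j)%N = k.+1 -> (i + j)%N = k.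
Proof. by case. Qed.

Lemma add_pred j k : (0 + j.+1)%N = k.+1 -> (0 + j)%N = k.
Proof. by case. Qed.

Lemma add_succ_pred i j k : (i.+1 + j.+1)%N = k.+1 -> (i.+1 + j)%N = k.
Proof. by rewrite addnS => -[]. Qed.

(* The element (a, c) stands for a + y c, where the exterior variable y has
   degree 1 and differential r. *)
Definition scone_mul (i j k : nat) : (i + j)%N = k -> P i -> P j -> P k :=
  match i, j, k return
    (i + j)%N = k -> cone_obj A A i -> cone_obj A A j -> cone_obj A A k
  with
  | 0%N, 0%N, 0%N => fun e a b => mul e a b
  | 0%N, j'.+1, k'.+1 => fun e a y =>
      (mul e a y.1, mul (add_pred e) a y.2)
  | i'.+1, 0%N, k'.+1 => fun e x b =>
      (mul e x.1 b, mul (succ_add_pred e) x.2 b)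
  | i'.+1, j'.+1, k'.+1 => fun e x y =>
      (mul e x.1 y.1,
       mul (succ_add_pred e) x.2 y.1
       + (-1) ^+ i'.+1 *: mul (add_succ_pred e) x.1 y.2)
  | _, _, _ => fun _ _ _ => 0
  end.

(** The second component of the Leibniz rule for (a, a') and (b, b'), with t the sign of the degree
    of a' and p, q, w, x, y standing for da' b, a' db, a' b', da b', a db'. The two terms in r
    cancel. *)
Lemma scone_leibniz_identity (V : lmodType R) (p q w x y : V) (t : R) :
  t * t = 1 ->
  - (p + t *: q + (- t) *: (x + (- t) *: y))
  = - p + t *: (x + r *: w) + (- t) *: (q + r *: w + (- t) *: (- y)).
Proof.
move=> tt; have tN (v : V) : (- t) *: ((- t) *: v) = v.
  by rewrite scalerA mulrNN tt scale1r.
rewrite !(scalerDr (- t)) !tN !scaleNr !scalerDr !opprD !opprK -!addrA.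
by congr (_ + _); rewrite [LHS]addrCA; congr (_ + _); rewrite [RHS]addrCA;
  congr (_ + _); rewrite addrA subrr add0r.
Qed.

Notation mulE := (dg_mulDl hA, dg_mulZl hA, dg_mulNl hA,
                  dg_mulDr hA, dg_mulZr hA, dg_mulNr hA).

Lemma scone_dg_algebra : dg_algebra (one : P 0%N) scone_mul.
Proof.
split.
- apply: cone_is_complex; try exact: dga_complex hA.
  by move=> i a; rewrite /= difZ.
- move=> [|i] [|j] [|k] // e b q x y; rewrite /= ?mulE //.
  apply: pair_ext; rewrite //= !scalerDr !scalerA [q * _]mulrC; exact: addrACA.
- move=> [|i] [|j] [|k] // e b q x y; rewrite /= ?mulE //.
  apply: pair_ext; rewrite //= !scalerDr !scalerA [q * _]mulrC; exact: addrACA.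
- by move=> [|j] e b; rewrite /= !(dga_onel hA) //; case: b.
- by move=> [|j] e b; rewrite /= !(dga_oner hA) //; case: b.
- move=> [|i] [|j] [|l] [|ij] [|jl] [|m] e1 e2 e3 e4 a b c //;
    rewrite /= ?mulE; try refine (dga_assoc hA _ _ _ _ _ _ _);
    apply: pair_ext; try refine (dga_assoc hA _ _ _ _ _ _ _);
    rewrite /= ?mulE ?scalerDr ?scalerA ?addrA.
  + have -> : (-1) ^+ ij.+1 = (-1) ^+ j.+1 :> R by rewrite -e1.
    congr (_ + _ *: _); refine (dga_assoc hA _ _ _ _ _ _ _).
  + have -> : (-1) ^+ ij.+1 = (-1) ^+ i.+1 :> R by rewrite -e1 addn0.
    congr (_ + _ *: _); refine (dga_assoc hA _ _ _ _ _ _ _).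
  + congr (_ + _ *: _); refine (dga_assoc hA _ _ _ _ _ _ _).
  + have -> : (-1) ^+ ij.+1 = (-1) ^+ i.+1 * (-1) ^+ j.+1 :> R by rewrite -exprD e1.
    congr (_ + _ *: _ + _ *: _); refine (dga_assoc hA _ _ _ _ _ _ _).
- exact: dga_degree0 hA.
- have fst_eq i j k (e : (i.+1 + j.+1)%N = k.+2) (e1 : (i + j.+1)%N = k.+1)
      (e2 : (i.+1 + j)%N = k.+1) (a : A i.+1) (a' : A i) (b : A j.+1) (b' : A j) :
      dif A k.+1 (mul e a b)
        + r *: (mul (succ_add_pred e) a' b + (-1) ^+ i.+1 *: mul (add_succ_pred e) a b')
      = mul e1 (dif A i a + r *: a') b
        + (-1) ^+ i.+1 *: mul e2 a (dif A j b + r *: b').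
    rewrite !mulE (dga_leibniz hA e e1 e2) !scalerDr !addrA.
    rewrite (eq_irrelevance (succ_add_pred e) e1).
    rewrite (eq_irrelevance (add_succ_pred e) e2) !scalerA [r * _]mulrC.
    by congr (_ + _); exact: addrAC.
  (* If a' or b' has degree 0, it has no differential, and the corresponding argument of
     [scone_leibniz_identity] is 0. *)
  move=> [|i] [|j] [|k] e e1 e2 [a a'] [b b'] //; apply: pair_ext;
    try exact: fst_eq; rewrite /= ?mulE difD difZ.
  + rewrite (dga_leibniz0l hA (succ_add_pred e) (add_pred e1)).
    rewrite (dga_leibniz0r hA (add_succ_pred e) (add_pred e1)).
    rewrite (eq_irrelevance (succ_add_pred e2) (add_pred e1)).
    have := scone_leibniz_identity 0 (mul (add_pred e1) a' (dif A 0%N b))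
      (mul (add_pred e1) a' b') (mul (add_pred e1) (dif A 0%N a) b') 0 (mulr1 1).
    by rewrite !(scaler0, add0r, addr0, oppr0, scale1r, expr1).
  + rewrite (dga_leibniz0l hA (succ_add_pred e) (add_pred e1)).
    rewrite (dga_leibniz hA (add_succ_pred e) (add_pred e1) (add_succ_pred e2)).
    rewrite (eq_irrelevance (succ_add_pred e2) (add_pred e1)).
    have := scone_leibniz_identity 0 (mul (add_pred e1) a' (dif A j.+1 b))
      (mul (add_pred e1) a' b') (mul (add_pred e1) (dif A 0%N a) b')
      (mul (add_succ_pred e2) a (dif A j b')) (mulr1 1).
    by rewrite !(scaler0, add0r, addr0, oppr0, scale1r, expr1) ?scaleN1r ?opprK.
  + rewrite (dga_leibniz hA (succ_add_pred e) (succ_add_pred e1) (succ_add_pred e2)).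
    rewrite (dga_leibniz0r hA (add_succ_pred e) (add_succ_pred e1)).
    rewrite (eq_irrelevance (succ_add_pred e2) (add_succ_pred e1)).
    have := scone_leibniz_identity (mul (succ_add_pred e1) (dif A i a') b)
      (mul (add_succ_pred e1) a' (dif A 0%N b)) (mul (add_succ_pred e1) a' b')
      (mul (add_succ_pred e1) (dif A i.+1 a) b') 0.
    move=> /(_ ((-1) ^+ i.+1)); rewrite -exprMn mulrNN mulr1 expr1n => /(_ erefl).
    by rewrite !(scaler0, addr0, oppr0) -[- (-1) ^+ i.+1]mulN1r -exprS.
  + rewrite (dga_leibniz hA (succ_add_pred e) (succ_add_pred e1) (succ_add_pred e2)).
    rewrite (dga_leibniz hA (add_succ_pred e) (add_succ_pred e1) (add_succ_pred e2)).
    rewrite (eq_irrelevance (succ_add_pred e2) (add_succ_pred e1)).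
    have := scone_leibniz_identity (mul (succ_add_pred e1) (dif A i a') b)
      (mul (add_succ_pred e1) a' (dif A j.+1 b)) (mul (add_succ_pred e1) a' b')
      (mul (add_succ_pred e1) (dif A i.+1 a) b') (mul (add_succ_pred e2) a (dif A j b')).
    move=> /(_ ((-1) ^+ i.+1)); rewrite -exprMn mulrNN mulr1 expr1n => /(_ erefl).
    by rewrite -[- (-1) ^+ i.+1]mulN1r -exprS.
- move=> [|j] [|k] e e' a [b b'] //.
    by rewrite /= ?mulE (dga_leibniz0l hA e e') (eq_irrelevance (add_pred e) e').
  rewrite /= ?mulE; apply: pair_ext; rewrite /=.
    by rewrite (dga_leibniz0l hA e e') (eq_irrelevance (add_pred e) e').
  by rewrite (dga_leibniz0l hA (add_pred e) (add_pred e')).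
- move=> [|i] [|k] e e' [a a'] b //.
    rewrite /= ?mulE (dga_leibniz0r hA e e').
    by rewrite (eq_irrelevance (succ_add_pred e) e').
  rewrite /= ?mulE; apply: pair_ext; rewrite /=.
    by rewrite (dga_leibniz0r hA e e') (eq_irrelevance (succ_add_pred e) e').
  by rewrite (dga_leibniz0r hA (succ_add_pred e) (succ_add_pred e')).
Qed.

Lemma scone_strictly_commutative : strictly_commutative scone_mul.
Proof.
case: hC => com sq; split.
  move=> [|i] [|j] [|k] // e e' a b; rewrite /=; try exact: com.
  - apply: pair_ext; first exact: com; exact: com.
  - apply: pair_ext; first exact: com; exact: com.
  - apply: pair_ext; rewrite /=; first exact: com.
    rewrite (com _ _ _ (succ_add_pred e) (add_succ_pred e')).
    rewrite (com _ _ _ (add_succ_pred e) (succ_add_pred e')).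
    rewrite scalerDr !scalerA -!exprD addrC; congr (_ + _).
      by congr (_ *: _); apply: signr_eq; rewrite -mulnS.
    congr (_ *: _); apply: signr_eq.
    by rewrite mulSn !oddD addbC addbA addbb.
move=> [|i] [|k] // e a oi; apply: pair_ext; rewrite /=; first exact: sq.
(* The second component of the square of a + y c is c a - a c, and c has even degree. *)
rewrite (com _ _ _ (succ_add_pred e) (add_succ_pred e)).
rewrite -signr_odd oddM /= -[in (-1) ^+ i.+1]signr_odd oi.
by move: oi => /= /negPf ->; rewrite scale1r expr1 scaleN1r subrr.
Qed.

End ScalarCone.

(** * Subalgebras of a product of two dg algebras *)

Section DgSubalgebra.
Variables (R : comNzRingType) (P D1 D2 : complex R).
Variables (one1 : D1 0%N) (mul1 : products D1) (one2 : D2 0%N) (mul2 : products D2).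
Variables (f1 : gmap P D1) (f2 : gmap P D2) (one : P 0%N).
Hypotheses (hD1 : dg_algebra one1 mul1) (hC1 : strictly_commutative mul1).
Hypotheses (hD2 : dg_algebra one2 mul2) (hC2 : strictly_commutative mul2).
Hypotheses (hf1 : chain_map f1) (hf2 : chain_map f2).
Hypothesis f_inj : forall i (x y : P i), f1 i x = f1 i y -> f2 i x = f2 i y -> x = y.
Hypotheses (f1_one : f1 0%N one = one1) (f2_one : f2 0%N one = one2).
Hypothesis degree0 : forall a : P 0%N, exists! q : R, a = q *: one.
Variable f_mul : forall i j k (e : (i + j)%N = k) (x : P i) (y : P j),
  {p : P k | f1 k p = mul1 e (f1 i x) (f1 j y) /\ f2 k p = mul2 e (f2 i x) (f2 j y)}.

Definition sub_mul : products P := fun i j k e x y => sval (f_mul e x y).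

Lemma sub_mul1 i j k (e : (i + j)%N = k) x y :
  f1 k (sub_mul e x y) = mul1 e (f1 i x) (f1 j y).
Proof. by rewrite /sub_mul; case: f_mul => p []. Qed.

Lemma sub_mul2 i j k (e : (i + j)%N = k) x y :
  f2 k (sub_mul e x y) = mul2 e (f2 i x) (f2 j y).
Proof. by rewrite /sub_mul; case: f_mul => p []. Qed.

(** The maps [f1] and [f2] are jointly injective and, apart from [degree0], the axioms are
    equations, so each may be checked in D1 and in D2. *)
Lemma sub_dg_algebra : dg_algebra one sub_mul.
Proof.
split.
- move=> i a; apply: f_inj.
    by rewrite !hf1 (dga_complex hD1) raddf0.
  by rewrite !hf2 (dga_complex hD2) raddf0.
- move=> i j k e b q x y; apply: f_inj.
    by rewrite linearP !sub_mul1 linearP (dga_linearl hD1).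
  by rewrite linearP !sub_mul2 linearP (dga_linearl hD2).
- move=> i j k e b q x y; apply: f_inj.
    by rewrite linearP !sub_mul1 linearP (dga_linearr hD1).
  by rewrite linearP !sub_mul2 linearP (dga_linearr hD2).
- move=> j e b; apply: f_inj.
    by rewrite sub_mul1 f1_one (dga_onel hD1).
  by rewrite sub_mul2 f2_one (dga_onel hD2).
- move=> i e a; apply: f_inj.
    by rewrite sub_mul1 f1_one (dga_oner hD1).
  by rewrite sub_mul2 f2_one (dga_oner hD2).
- move=> i j k ij jk l e1 e2 e3 e4 a b c; apply: f_inj.
    by rewrite !sub_mul1 (dga_assoc hD1 e1 e2 e3 e4).
  by rewrite !sub_mul2 (dga_assoc hD2 e1 e2 e3 e4).
- exact: degree0.
- move=> i j k e e1 e2 a b; apply: f_inj.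
    by rewrite hf1 linearD linearZ !sub_mul1 (dga_leibniz hD1 e e1 e2) !hf1.
  by rewrite hf2 linearD linearZ !sub_mul2 (dga_leibniz hD2 e e1 e2) !hf2.
- move=> j k e e' a b; apply: f_inj.
    by rewrite hf1 !sub_mul1 (dga_leibniz0l hD1 e e') hf1.
  by rewrite hf2 !sub_mul2 (dga_leibniz0l hD2 e e') hf2.
- move=> i k e e' a b; apply: f_inj.
    by rewrite hf1 !sub_mul1 (dga_leibniz0r hD1 e e') hf1.
  by rewrite hf2 !sub_mul2 (dga_leibniz0r hD2 e e') hf2.
Qed.

Lemma sub_strictly_commutative : strictly_commutative sub_mul.
Proof.
split=> [i j k e e' a b|i k e a oi]; apply: f_inj.
- by rewrite linearZ !sub_mul1 (hC1.1 _ _ _ e e').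
- by rewrite linearZ !sub_mul2 (hC2.1 _ _ _ e e').
- by rewrite sub_mul1 hC1.2 // raddf0.
- by rewrite sub_mul2 hC2.2 // raddf0.
Qed.

End DgSubalgebra.

(** * The multiplication on the cone *)

Section SuspensionTaylor.
Variables (k : fieldType) (n : nat) (C : {set 'I_n}) (ltC : rel 'I_n).
Notation Q := {mpoly k[n.+1]}.
Notation K := (koszulK k C ltC).
Notation F := (taylorF k C ltC).
Notation z := ('X_ord_max : Q).
Notation zvert := (fun v => z_mon n + vert_mon v)%MM.

Lemma vert_inj : injective (@vert n).
Proof. by move=> u v /(congr1 val) /= /val_inj. Qed.

Lemma vert_neq_max (v : 'I_n) : vert v != ord_max.
Proof. by rewrite -val_eqE /= neq_ltn ltn_ord. Qed.

(** For the empty set the lcm has no factor z. Therefore the differentials of F and K agree above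
    degree 1, where all faces are nonempty, and differ by z in degree 1. *)
Lemma lcm_zvert (U : {set 'I_n}) :
  U != set0 -> lcm_set zvert U = (z_mon n + lcm_set (@vert_mon n) U)%MM.
Proof.
case/set0Pn => v vU; apply/mnmP => j; rewrite mnmDE !lcm_setE.
apply/eqP; rewrite eqn_leq; apply/andP; split.
  apply/bigmax_leqP => w wU; rewrite mnmDE leq_add2l.
  exact: leq_bigmax_cond wU.
have [w wU ->] : {w | w \in U & \max_(x in U) vert_mon x j = vert_mon w j}.
  by apply: eq_bigmax_cond; apply/card_gt0P; exists v.
by rewrite -mnmDE; apply: leq_bigmax_cond wU.
Qed.

Lemma taylorF_dcoefS (U U' : {set 'I_n}) : (1 < #|U|)%N ->
  taylor_dcoef k ltC zvert U U' = taylor_dcoef k ltC (@vert_mon n) U U'.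
Proof.
move=> cU; apply: eq_bigr => x /andP[xU _]; congr (_ * 'X_[_]).
rewrite !lcm_zvert; first by apply/mnmP => j; rewrite !mnmBE !mnmDE subnDl.
  by rewrite -card_gt0; move: cU; rewrite (cardsD1 x) xU.
by apply/set0Pn; exists x.
Qed.

Lemma taylorF_dcoef1 (U U' : {set 'I_n}) : #|U| = 1%N ->
  taylor_dcoef k ltC zvert U U' = z * taylor_dcoef k ltC (@vert_mon n) U U'.
Proof.
move=> /eqP/cards1P[x ->]; rewrite mulr_sumr; apply: eq_bigr => y /andP[/set1P -> _].
rewrite mulrCA -mpolyXD lcm_zvert; last by apply/set0Pn; exists x; rewrite set11.
rewrite setDv !lcm_set0; congr (_ * 'X_[_]).
by apply/mnmP => j; rewrite !(mnmDE, mnmBE) mnm0E !subn0.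
Qed.

Lemma taylorF_difS i (x : taylor_obj k n.+1 C i.+2) : dif F i.+1 x = dif K i.+1 x.
Proof.
apply/ffunP => U; rewrite !ffunE; apply: eq_bigr => W _; congr (_ * _).
by apply: taylorF_dcoefS; case: (cellP W) => _ ->.
Qed.

Lemma taylorF_dif0 (x : taylor_obj k n.+1 C 1) : dif F 0%N x = z *: dif K 0%N x.
Proof.
apply/ffunP => U; rewrite !ffunE /GRing.scale /= mulr_sumr.
apply: eq_bigr => W _; rewrite mulrCA; congr (_ * _).
by apply: taylorF_dcoef1; case: (cellP W) => _ ->.
Qed.

End SuspensionTaylor.

Section TaylorScale.
Variables (k : fieldType) (N : nat) (I : finType) (S : {set I}) (i : nat).
Implicit Types f g : taylor_obj k N S i.

Lemma taylor_scaleE q f U : (q *: f) U = q * f U.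
Proof. by rewrite ffunE. Qed.

Lemma taylor_scaleX_inj v f g : 'X_v *: f = 'X_v *: g -> f = g.
Proof.
move=> h; apply/ffunP => U; apply: (@mulXv_inj _ _ v).
exact: etrans (esym (taylor_scaleE _ f U))
  (etrans (congr1 (fun f : taylor_obj k N S i => f U) h) (taylor_scaleE _ g U)).
Qed.

End TaylorScale.

(** * The embedding of the cone into G[y] and K, and the induced product *)

Section SuspensionAlgebra.
Variables (k : fieldType) (n : nat) (C : {set 'I_n}) (ltC : rel 'I_n).
Hypothesis hltC : strict_total_order C ltC.
Notation Q := {mpoly k[n.+1]}.
Notation K := (koszulK k C ltC).
Notation F := (taylorF k C ltC).
Notation z := ('X_ord_max : Q).
Variables (G : complex Q) (oneG : G 0%N) (mulG : products G).
Hypotheses (hGdg : dg_algebra oneG mulG) (hGcomm : strictly_commutative mulG).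
Variable tau : gmap G K.
Hypotheses (htau_chain : chain_map tau).
Hypothesis htau_one : tau 0%N oneG = koszulK_one k C ltC.
Notation P := (cone (beta oneG tau)).
Notation Gz := (cone (scale_gmap G (- z))).
Notation M := (M_obj G F).

Lemma K_dg_algebra : dg_algebra (koszulK_one k C ltC) (koszulK_mul k n C ltC).
Proof. exact: taylor_dg_algebra. Qed.

(** As tau preserves the unit, [taylor0] after tau is the coordinate on G_0. This gives an explicit
    scalar where [dga_degree0] only asserts existence. *)
Lemma degree0E (a : G 0%N) : a = taylor0 (tau 0%N a) *: oneG.
Proof.
have [q [-> _]] := dga_degree0 hGdg a.
by rewrite linearZ htau_one (linearZ_of (@taylor0_linear _ _ _ _ ltC (@vert_mon n)))
  /= taylor0_one /GRing.scale /= mulr1.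
Qed.

(** M_0 is F_1 alone, without a component in G. The component in F is read in K, which has the same
    modules. *)
Definition cone_b i : M i -> K i.+1 :=
  match i return M i -> K i.+1 with 0%N => id | i'.+1 => fst end.

(* In degree 1 the y-coefficient is forced by compatibility with the
   differentials, as elements of degree 1 have no third component. *)
Definition cone_c i : M i -> G i :=
  match i return M i -> G i with
  | 0%N => fun m => - (taylor0 (dif K 0%N m) *: oneG)
  | i'.+1 => snd
  end.

Definition toGz_fun i : P i -> Gz i :=
  match i return P i -> Gz i with
  | 0%N => id
  | i'.+1 => fun x => (x.1, cone_c x.2)
  end.

Definition toK_fun i : P i -> K i :=
  match i return P i -> K i with
  | 0%N => tau 0%N
  | i'.+1 => fun x => tau i'.+1 x.1 + z *: cone_b x.2
  end.

Lemma cone_c_linear i : linear (@cone_c i).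
Proof.
case: i => [|i] q x y; last by [].
rewrite /cone_c dif_linear (taylor0_linear q) scalerDl opprD scalerN.
by congr (- _ - _); rewrite scalerA.
Qed.

Lemma toGz_linear i : linear (@toGz_fun i).
Proof. by case: i => [|i] q x y //=; rewrite cone_c_linear. Qed.

Lemma toK_linear i : linear (@toK_fun i).
Proof.
case: i => [|i] q x y; first exact: linearP.
have bl : cone_b (q *: x + y).2 = q *: cone_b x.2 + cone_b y.2 by case: i x y.
have al : (q *: x + y).1 = q *: x.1 + y.1 by [].
rewrite /toK_fun bl al linearP !scalerDr !scalerA [z * q]mulrC; exact: addrACA.
Qed.

Definition toGz : gmap P Gz := fun i => mklin (@toGz_linear i).
Definition toK : gmap P K := fun i => mklin (@toK_linear i).

Lemma cone_dif0 (x : P 1%N) :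
  dif P 0%N x = dif G 0%N x.1 + taylor0 (z *: dif K 0%N x.2) *: oneG.
Proof. by rewrite -taylorF_dif0. Qed.

Lemma cone_dif1 (x : P 2%N) :
  dif P 1%N x = (dif G 1%N x.1 - z *: x.2.2, dif K 1%N x.2.1 + tau 1%N x.2.2).
Proof.
apply: pair_ext => //; apply: etrans (opprD _ _) _.
by rewrite !opprK; congr (_ + _); exact: taylorF_difS.
Qed.

Lemma cone_difS i (x : P i.+3) :
  dif P i.+2 x =
  (dif G i.+2 x.1 - z *: x.2.2,
   (dif K i.+2 x.2.1 + tau i.+2 x.2.2, - dif G i.+1 x.2.2)).
Proof.
apply: pair_ext => //; apply: pair_ext => //; apply: etrans (opprD _ _) _.
by rewrite !opprK; congr (_ + _); exact: taylorF_difS.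
Qed.

Lemma toGz_chain : chain_map toGz.
Proof.
case=> [|[|i]] x.
- rewrite cone_dif0; apply: congr1 => /=.
  rewrite (linearZ_of (@taylor0_linear _ _ _ _ ltC (@vert_mon n))).
  by rewrite scaleNr scalerN opprK scalerA.
- rewrite cone_dif1; apply: pair_ext; first by rewrite /= scaleNr.
  (* In degree 2 the y-coefficient of the boundary is minus the scalar of d(db + tau c) = tau(dc),
     which [degree0E] identifies with - dc. *)
  change (- (taylor0 (dif K 0%N (dif K 1%N x.2.1 + tau 1%N x.2.2)) *: oneG)
          = - dif G 0%N x.2.2).
  rewrite difD (taylor_complex hltC) add0r -htau_chain.
  by rewrite -degree0E.
- by rewrite cone_difS; apply: pair_ext; rewrite /= ?scaleNr.
Qed.

(** The two terms q f(c) cancel. With q = z and f = tau this is the compatibility of [toK] in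
    degrees at least 2. *)
Lemma chain_map_homotopy (A B : complex Q) (f : gmap A B) (q : Q) i
    (a : A i.+1) (c : A i) (b : B i.+1) : chain_map f ->
  f i (dif A i a - q *: c) + q *: (dif B i b + f i c)
  = dif B i (f i.+1 a + q *: b).
Proof.
move=> hf; rewrite difD difZ linearB linearZ hf scalerDr [q *: _ + _]addrC.
by rewrite addrA subrK.
Qed.

Lemma chain_map_scale (A B : complex Q) (f : gmap A B) (q t : Q) i
    (a : A i.+1) (c : A i) (b : B i.+1) :
  chain_map f -> q *: dif B i b = t *: f i c ->
  f i (dif A i a + t *: c) = dif B i (f i.+1 a + q *: b).
Proof. by move=> hf hb; rewrite difD difZ linearD linearZ hf hb. Qed.

Lemma toK_chain : chain_map toK.
Proof.
case=> [|[|i]] x.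
- rewrite cone_dif0.
  change (tau 0%N (dif G 0%N x.1 + taylor0 (z *: dif K 0%N x.2) *: oneG)
          = dif K 0%N (tau 1%N x.1 + z *: (x.2 : K 1%N))).
  apply: chain_map_scale => //; rewrite htau_one; exact: taylor0E.
- rewrite cone_dif1; exact: chain_map_homotopy.
- rewrite cone_difS; exact: chain_map_homotopy.
Qed.

(** The component a, and c where there is one, is read off from [toGz]. Then [toK] determines z b,
    and z is regular on K. *)
Lemma to_inj i (x y : P i) :
  toGz i x = toGz i y -> toK i x = toK i y -> x = y.
Proof.
case: i x y => [|i] x y; first by [].
move=> hG; have E1 : x.1 = y.1 := congr1 fst hG.
have E2 : cone_c x.2 = cone_c y.2 := congr1 snd hG.
move=> /= hK; have {hK} : z *: cone_b x.2 = z *: cone_b y.2.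
  by move: hK; rewrite E1; exact: addrI.
move=> hb; have {hb} E3 : cone_b x.2 = cone_b y.2.
  exact: taylor_scaleX_inj hb.
apply: pair_ext => //; case: i x y {hG E1} E2 E3 => [|i] x y //= E2 E3.
exact: pair_ext.
Qed.

Lemma to_mul : dg_morphism oneG mulG (koszulK_one k C ltC) (koszulK_mul k n C ltC) tau ->
  forall i j l (e : (i + j)%N = l) (x : P i) (y : P j),
  {p : P l | toGz l p = scone_mul mulG e (toGz i x) (toGz j y) /\
             toK l p = koszulK_mul k n C ltC i j l e (toK i x) (toK j y)}.
Proof.
move=> [_ _ tau_mul]; have hGz := scone_dg_algebra (- z) hGdg.
have hK := K_dg_algebra.
(* A factor of degree 0 is a scalar multiple of the unit, and the product is that multiple of the
   other factor. *)
case=> [|i] j l e x y.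
  have ej : j = l by [].
  case: l / ej e => e; exists (taylor0 (tau 0%N x) *: y).
  by rewrite (dg_mul_scalarl hGz _ _ (degree0E x : toGz 0%N x = _))
    (dg_mul_scalarl hK _ _ (taylor0E _ : toK 0%N x = _)) !linearZ.
case: j e y => [|j] e y.
  have el : i.+1 = l by rewrite -e addn0.
  case: l / el e => e; exists (taylor0 (tau 0%N y) *: x).
  by rewrite (dg_mul_scalarr hGz _ _ (degree0E y : toGz 0%N y = _))
    (dg_mul_scalarr hK _ _ (taylor0E _ : toK 0%N y = _)) !linearZ.
case: l e => [|[|l]] e; [by []|by exfalso; have := e; rewrite addSn addnS|].
(* Now the product has degree at least 2, where all three components are free. The outer ones form
   the product in G[y]; the middle one is what z multiplies in the product of tau a + z b and tau a'
   + z b'. *)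
exists (mulG e x.1 y.1,
  (koszulK_mul k n C ltC _ _ _ e (tau i.+1 x.1) (cone_b y.2)
   + koszulK_mul k n C ltC _ _ _ e (cone_b x.2) (tau j.+1 y.1)
   + z *: koszulK_mul k n C ltC _ _ _ e (cone_b x.2) (cone_b y.2),
   (scone_mul mulG e (toGz i.+1 x) (toGz j.+1 y)).2)).
split; first exact: pair_ext.
apply: etrans (esym (dg_mul_perturb hK e z _ _ _ _)).
by apply: (congr1 (fun v => v + _)); exact: tau_mul.
Qed.

Lemma suspension_dg_algebra :
  dg_morphism oneG mulG (koszulK_one k C ltC) (koszulK_mul k n C ltC) tau ->
  exists (one : P 0%N) (mul : products P),
    dg_algebra one mul /\ strictly_commutative mul.
Proof.
move=> htau; have hGz := scone_dg_algebra (- z) hGdg.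
have hGzC := scone_strictly_commutative (- z) hGcomm.
have hKC : strictly_commutative (koszulK_mul k n C ltC).
  exact: taylor_strictly_commutative.
exists (oneG : P 0%N), (sub_mul (to_mul htau)); split.
  exact: (sub_dg_algebra hGz K_dg_algebra toGz_chain toK_chain to_inj
    (erefl oneG) htau_one (dga_degree0 hGdg : forall a : P 0%N, _) (to_mul htau)).
exact: (sub_strictly_commutative hGzC hKC to_inj (to_mul htau)).
Qed.


End SuspensionAlgebra.

(** * The cone as a free resolution *)

Section Bases.
Variable R : comNzRingType.

Definition pair_basis (M1 M2 : lmodType R) (I J : Type) (b1 : I -> M1)
    (b2 : J -> M2) (s : I + J) : (M1 * M2)%type :=
  match s with inl i => (b1 i, 0) | inr j => (0, b2 j) end.

Lemma pair_basis_sum (M1 M2 : lmodType R) (I J : finType) (b1 : I -> M1)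
    (b2 : J -> M2) (P : pred (I + J)) (c : I + J -> R) :
  \sum_(s | P s) c s *: pair_basis b1 b2 s
  = (\sum_(i | P (inl i)) c (inl i) *: b1 i,
     \sum_(j | P (inr j)) c (inr j) *: b2 j).
Proof.
rewrite big_mkcond big_sumType -!big_mkcond /=; apply: pair_ext; rewrite /=.
  rewrite !(raddf_sum fst) /= [X in _ + X]big1 ?addr0 // => j _; exact: scaler0.
rewrite !(raddf_sum snd) /= big1 ?add0r // => i _; exact: scaler0.
Qed.

Lemma is_basis_pair (M1 M2 : lmodType R) (I J : finType) (b1 : I -> M1)
    (b2 : J -> M2) : is_basis b1 -> is_basis b2 -> is_basis (pair_basis b1 b2).
Proof.
move=> h1 h2 [x y]; have [c1 [xE uc1]] := h1 x; have [c2 [yE uc2]] := h2 y.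
exists [ffun s => match s with inl i => c1 i | inr j => c2 j end]; split.
  rewrite pair_basis_sum {1}xE {1}yE.
  by apply: pair_ext; apply: eq_bigr => i _; rewrite ffunE.
move=> c; rewrite pair_basis_sum => -[xc yc]; apply/ffunP => -[i|j]; rewrite ffunE.
  rewrite (uc1 [ffun i => c (inl i)]) ?ffunE // xc.
  by apply: eq_bigr => i' _; rewrite ffunE.
rewrite (uc2 [ffun j => c (inr j)]) ?ffunE // yc.
by apply: eq_bigr => i' _; rewrite ffunE.
Qed.

Lemma is_basis_fg_free (M : lmodType R) (I : finType) (b : I -> M) :
  is_basis b -> fg_free M.
Proof.
move=> hb; exists #|I|, (fun i => b (enum_val i)) => x.
have [c [xE uc]] := hb x; exists [ffun i => c (enum_val i)]; split.
  rewrite {1}xE (reindex (@enum_val I xpredT)) /=; last first.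
    by exists enum_rank => i _; rewrite ?enum_valK ?enum_rankK.
  by apply: eq_bigr => i _; rewrite ffunE.
move=> c' xE'; apply/ffunP => i; rewrite ffunE.
rewrite (uc [ffun y => c' (enum_rank y)]) ?ffunE ?enum_valK // xE'.
rewrite [RHS](reindex (@enum_val I xpredT)) /=; last first.
  by exists enum_rank => j _; rewrite ?enum_valK ?enum_rankK.
by apply: eq_bigr => j _; rewrite ffunE enum_valK.
Qed.

Lemma fg_free_pair (M1 M2 : lmodType R) :
  fg_free M1 -> fg_free M2 -> fg_free (M1 * M2)%type.
Proof.
by move=> [r1 [b1 h1]] [r2 [b2 h2]]; apply: is_basis_fg_free (is_basis_pair h1 h2).
Qed.

End Bases.

Lemma taylor_basis (k : fieldType) (N : nat) (I : finType) (S : {set I}) i :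
  is_basis (fun U : cell S i => tgen S i (val U) : taylor_obj k N S i).
Proof.
move=> f; exists (f : {ffun cell S i -> {mpoly k[N]}}); split.
  exact: taylor_sum.
move=> c ->; apply/ffunP => U; rewrite sum_ffunE (bigD1 U) //= big1 ?addr0.
  by rewrite taylor_scaleE tgenE eqxx mulr1.
by move=> W WU; rewrite taylor_scaleE tgenE (negPf WU) mulr0.
Qed.

(** * Edge ideals and the ideal of the suspension *)

Section EdgeIdeal.
Variables (k : fieldType) (N : nat) (E : {set {set 'I_N}}).
Implicit Types p q : {mpoly k[N]}.
Notation I := (@edge_ideal k N E).

Lemma edge_idealD p q : I p -> I q -> I (p + q).
Proof.
move=> [c ->] [d ->]; exists (fun w => c w + d w).
by rewrite -big_split; apply: eq_bigr => w _; rewrite mulrDl.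
Qed.

Lemma edge_idealM p q : I q -> I (p * q).
Proof.
move=> [c ->]; exists (fun w => p * c w); rewrite mulr_sumr.
by apply: eq_bigr => w _; rewrite mulrA.
Qed.

Lemma edge_idealN p : I p -> I (- p).
Proof. by move=> Ip; rewrite -mulN1r; apply: edge_idealM. Qed.

(** No edge monomial involves v, so division by ['X_v] passes to the coefficients. For v the last
    variable this is the regularity of z modulo I(G). *)
Lemma edge_ideal_var_quot v p : {in E, forall w : {set 'I_N}, v \notin w} ->
  I ('X_v * p) -> I p.
Proof.
move=> vE [c vpE]; exists (fun w => var_quot v (c w)).
rewrite -(var_quotXv v p) vpE raddf_sum; apply: eq_bigr => w wE /=.
have -> : \prod_(u in w) 'X_u = 'X_[\sum_(u in w) U_(u)%MM] :> {mpoly k[N]}.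
  by rewrite (big_morph _ (@mpolyXD _ _) (@mpolyX0 _ _)).
rewrite mulrC var_quotMX 1?mulrC // mnm_sumE big1 // => u uw; rewrite mnm1E.
by case: eqVneq uw => // ->; rewrite (negPf (vE w wE)).
Qed.

(** v inverts u modulo the ideal. An augmentation need not send the unit to 1, only to such a u. *)
Lemma edge_ideal_unit u v q : I (v * u - 1) -> I (q * u) <-> I q.
Proof.
move=> Ivu; split=> [Iqu|Iq]; last by rewrite mulrC; apply: edge_idealM.
have -> : q = v * (q * u) - q * (v * u - 1).
  by rewrite mulrBr mulr1 mulrCA opprB addrCA subrr addr0.
by apply: edge_idealD; [|apply: edge_idealN]; apply: edge_idealM.
Qed.

End EdgeIdeal.

Section SuspensionIdeal.
Variables (k : fieldType) (n : nat) (E : {set {set 'I_n}}) (C : {set 'I_n}).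
Notation Q := {mpoly k[n.+1]}.
Notation I := (edge_ideal k (extend_graph E)).
Notation z := ('X_ord_max : Q).

Lemma extend_graph_max : {in extend_graph E, forall w : {set 'I_n.+1}, ord_max \notin w}.
Proof.
move=> w /imsetP[w0 _ ->]; apply/imsetP => -[v _ vmax].
by have := vert_neq_max v; rewrite -vmax eqxx.
Qed.

Lemma suspension_ideal (q : Q) : edge_ideal k (suspension E C) q <->
  exists2 p : Q, I p &
    exists c : 'I_n -> Q, q = p + z * \sum_(v in C) c v * 'X_(vert v).
Proof.
pose cone_edge (v : 'I_n) : {set 'I_n.+1} := [set ord_max; vert v].
have inj : injective cone_edge.
  move=> u v uv; have : vert u \in cone_edge v by rewrite -uv !inE eqxx orbT.
  rewrite !inE (negPf (vert_neq_max u)) /= => /eqP; exact: vert_inj.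
have dis : [disjoint extend_graph E & [set cone_edge v | v in C]].
  rewrite disjoint_sym; apply/pred0P => w /=; apply/negP => /andP[/imsetP[v _ ->]].
  by move=> /extend_graph_max; rewrite !inE eqxx.
have sumE (c : {set 'I_n.+1} -> Q) :
    \sum_(w in suspension E C) c w * \prod_(v in w) 'X_v
    = \sum_(w in extend_graph E) c w * \prod_(v in w) 'X_v
      + z * \sum_(v in C) c (cone_edge v) * 'X_(vert v).
  rewrite (eq_bigl [predU extend_graph E & [set cone_edge v | v in C]]) => [|w]; last first.
    by rewrite !inE.
  rewrite bigU //=; congr (_ + _); rewrite big_imset /=; last by move=> u v _ _ /inj.
  rewrite mulr_sumr; apply: eq_bigr => v _; rewrite mulrCA; congr (_ * _).
  by rewrite big_setU1 ?big_set1 // inE eq_sym vert_neq_max.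
split=> [[c ->]|[_ [c ->] [d ->]]].
  exists (\sum_(w in extend_graph E) c w * \prod_(v in w) 'X_v); first by exists c.
  by exists (fun v => c (cone_edge v)); rewrite sumE.
(* No edge of G contains z, so the two families of edges are disjoint; at the edge zv the inner sum
   has the single term d v. *)
exists (fun w => if w \in extend_graph E then c w
                 else \sum_(v in C | w == cone_edge v) d v).
rewrite sumE; congr (_ + _ * _); first by apply: eq_bigr => w ->.
apply: eq_bigr => v vC; rewrite ifN; last first.
  by apply/negP => /extend_graph_max; rewrite !inE eqxx.
rewrite (big_pred1 v) // => u; rewrite andbC; case: eqP => /= [/inj <-|ne].
  by rewrite eqxx vC.
by case: eqP => // uv; case: ne; rewrite uv.
Qed.

Lemma edge_ideal_suspension (q : Q) : I q -> edge_ideal k (suspension E C) q.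
Proof.
move=> Iq; apply/suspension_ideal; exists q => //.
by exists (fun=> 0); rewrite big1 ?mulr0 ?addr0 // => v _; exact: mul0r.
Qed.

End SuspensionIdeal.

(** * The Koszul complex on the vertex cover *)

Section KoszulDegree0.
Variables (k : fieldType) (n : nat) (C : {set 'I_n}) (ltC : rel 'I_n).
Hypothesis hltC : strict_total_order C ltC.
Notation Q := {mpoly k[n.+1]}.
Notation K := (koszulK k C ltC).

Lemma koszulK_tgen_dif i (U : {set 'I_n}) : U \subset C -> #|U| = i.+1 ->
  dif K i (tgen C i.+1 U) =
  \sum_(v in U) ((-1) ^+ tsign ltC [set v] U * 'X_(vert v))
    *: (tgen C i (U :\ v) : K i).
Proof.
move=> sU cU; apply: etrans (tgen_dif _ _ _ sU cU) _.
apply: eq_bigr => v vU; congr (_ *: _).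
exact: (koszul_face_coef k ltC (@vert_inj n)).
Qed.

Lemma koszulK_dif1 v : v \in C ->
  dif K 0%N (tgen C 1 [set v]) = 'X_(vert v) *: koszulK_one k C ltC.
Proof.
move=> vC; rewrite koszulK_tgen_dif ?sub1set ?cards1 // big_set1.
by rewrite (tsign11 hltC vC) mul1r setDv.
Qed.

Lemma koszulK_dif0_ideal (q : Q) :
  (exists f : K 1%N, taylor0 (dif K 0%N f) = q) <->
  exists c : 'I_n -> Q, q = \sum_(v in C) c v * 'X_(vert v).
Proof.
pose d (f : K 1%N) : Q^o := taylor0 (dif K 0%N f).
have dlin : linear d.
  by move=> a f g; rewrite /d dif_linear; exact: (taylor0_linear a).
have dv v : v \in C -> d (tgen C 1 [set v]) = 'X_(vert v).
  move=> vC; rewrite /d koszulK_dif1 //.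
  apply: etrans (linearZ_of (@taylor0_linear _ _ _ C ltC (@vert_mon n)) _ _) _.
  by rewrite taylor0_one; exact: mulr1.
split=> [[f <-]|[c ->]]; last first.
  exists (\sum_(v in C) c v *: (tgen C 1 [set v] : K 1%N)).
  rewrite -/(d _) (linear_sum_of dlin); apply: eq_bigr => v vC.
  by rewrite (linearZ_of dlin) dv.
rewrite -/(d f) (taylor_sum f) (linear_sum_of dlin).
elim/big_ind: _ => [|_ _ [a ->] [b ->]|U _].
- by exists (fun=> 0); rewrite big1 // => v _; rewrite mul0r.
- exists (fun v => a v + b v); rewrite -big_split.
  by apply: eq_bigr => v _; rewrite mulrDl.
case: (cellP U) => sU /eqP/cards1P[v Uv]; rewrite Uv sub1set in sU *.
rewrite (linearZ_of dlin) dv //; exists (fun w => if w == v then f U else 0).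
rewrite (bigD1 v) //= eqxx big1 ?addr0 // => w /andP[_ /negPf ->].
by rewrite mul0r.
Qed.

Lemma koszulK_exact i (x : K i.+1) : dif K i x = 0 ->
  exists y, dif K i.+1 y = x.
Proof. exact: (koszul_exact hltC (@vert_inj n)). Qed.

End KoszulDegree0.

(** * Exactness and augmentation of the cone *)

Section SuspensionResolution.
Variables (k : fieldType) (n : nat) (E : {set {set 'I_n}}) (C : {set 'I_n}).
Variable ltC : rel 'I_n.
Hypothesis hltC : strict_total_order C ltC.
Notation Q := {mpoly k[n.+1]}.
Notation K := (koszulK k C ltC).
Notation F := (taylorF k C ltC).
Notation z := ('X_ord_max : Q).
Notation I := (edge_ideal k (extend_graph E)).
Variables (G : complex Q) (oneG : G 0%N) (mulG : products G).
Hypothesis hGdg : dg_algebra oneG mulG.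
Hypothesis hGres : free_resolution G I.
Variable tau : gmap G K.
Hypothesis htau_chain : chain_map tau.
Hypothesis htau_one : tau 0%N oneG = koszulK_one k C ltC.
Notation P := (cone (beta oneG tau)).

(** The chain maps [toGz] and [toK] are jointly injective and land in complexes. *)
Lemma cone_complex : is_complex P.
Proof.
move=> i a; apply: to_inj.
  rewrite !(toGz_chain hltC hGdg htau_chain htau_one).
  rewrite (dga_complex (scone_dg_algebra (- z) hGdg)).
  by rewrite raddf0.
rewrite !(toK_chain htau_chain htau_one) (dga_complex (K_dg_algebra k hltC)).
by rewrite raddf0.
Qed.

Lemma boundary_degree0 q : (exists b, dif G 0%N b = q *: oneG) <-> I q.
Proof.
case: hGres => _ _ _ [aug [onto ker]].
have augE p : aug (p *: oneG) = p * aug oneG by rewrite linearZ.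
have [a Ia] := onto 1; have [v [aE _]] := dga_degree0 hGdg a.
rewrite aE augE in Ia.
by rewrite -ker augE; exact: edge_ideal_unit Ia.
Qed.

Lemma G0_torsion_free (x : G 0%N) : z *: x = 0 -> x = 0.
Proof.
have [q [-> _]] := dga_degree0 hGdg x; rewrite scalerA => zq0.
have [q0 [_ uq]] := dga_degree0 hGdg 0.
have q00 : q0 = 0 by apply: uq; rewrite scale0r.
have : z * q = z * 0 by rewrite mulr0 -q00; apply/esym/uq; rewrite zq0.
by move/mulXv_inj ->; rewrite scale0r.
Qed.

Lemma cone_exact i (x : P i.+1) : dif P i x = 0 -> exists y, dif P i.+1 y = x.
Proof.
have [_ _ exG _] := hGres.
case: i x => [|i] [a m].
  rewrite cone_dif0 => dx.
  pose b : K 1%N := m.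
  pose t : Q := taylor0 (dif K 0%N b).
  have dx' : dif G 0%N a + (z * t) *: oneG = 0.
    rewrite -[RHS]dx; congr (_ + _ *: _).
    exact: esym (linearZ_of (@taylor0_linear _ _ _ C ltC (@vert_mon n)) z (dif K 0%N b)).
  (* The boundary of - a is z t, so z t lies in I, and hence so does t. *)
  have [a' da'] : exists a', dif G 0%N a' = t *: oneG.
    apply/boundary_degree0; apply: (edge_ideal_var_quot (@extend_graph_max n E)).
    apply/boundary_degree0; exists (- a).
    by apply/esym/eqP; rewrite difN -subr_eq0 opprK addrC dx'.
  (* Both tau a' and b have boundary t. *)
  have dK : dif K 0%N (tau 1%N a' - b) = 0.
    rewrite [LHS]difD [dif _ _ (- b)]difN -htau_chain da' linearZ htau_one.
    by apply/eqP; rewrite subr_eq0; apply/eqP; exact: esym (taylor0E _).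
  have [b' db'] := koszulK_exact hltC dK.
  have [|a'' da''] := exG 0%N (a + z *: a').
    by rewrite difD difZ da' scalerA dx'.
  exists (a'', (- b', a')); rewrite cone_dif1; apply: pair_ext.
    by rewrite /= da'' addrK.
  change (dif K 1%N (- b') + tau 1%N a' = b).
  by rewrite [dif _ _ _]difN db' opprB subrK.
case: m => b c dx.
have [da db dc] : [/\ dif G i.+1 a = z *: c, dif K i.+1 b = - tau i.+1 c &
                      dif G i c = 0].
  case: i a b c dx => [|i] a b c.
    rewrite cone_dif1 => -[/= da db].
    have da' : dif G 1%N a = z *: c by apply/eqP; rewrite -subr_eq0 da.
    split=> //; first by apply/eqP; rewrite -addr_eq0 db.
    (* For cycles of degree 2 the equation dc = 0 is not among the components; it follows from z dc
       = d(da) = 0. *)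
    apply: G0_torsion_free; rewrite -difZ -da'; exact: (dga_complex hGdg).
  rewrite cone_difS => -[/= da db dc]; split.
  - by apply/eqP; rewrite -subr_eq0 da.
  - by apply/eqP; rewrite -addr_eq0 db.
  - by apply/eqP; rewrite -oppr_eq0 dc.
have [c' dc'] := exG _ _ dc.
have [|a1 da1] := exG i.+1 (a - z *: c').
  by rewrite difD difN difZ da dc' subrr.
have [|b1 db1] := koszulK_exact hltC (x := (b : K i.+2) + tau i.+2 c').
  rewrite [LHS]difD.
  by rewrite db -htau_chain dc' addNr.
(* The cone takes its third component to minus its boundary, hence the sign of c'. *)
exists (a1, (b1, - c')); rewrite cone_difS; apply: pair_ext.
  by rewrite /= da1 scalerN opprK subrK.
apply: pair_ext; last by rewrite /= difN opprK dc'.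
change (dif K i.+2 b1 + tau i.+2 (- c') = b).
by rewrite db1 linearN addrK.
Qed.

(** The augmentation of G serves again. The boundaries grow from I to I plus z times the ideal of
    the cover, which is the edge ideal of the suspension. *)
Lemma cone_degree0 : exists aug : {linear P 0%N -> Q^o},
  (forall q : Q, exists a, edge_ideal k (suspension E C) (aug a - q)) /\
  (forall a, edge_ideal k (suspension E C) (aug a) <-> exists b, dif P 0%N b = a).
Proof.
case: hGres => _ _ _ [aug [onto ker]].
exists aug; split=> [q|a].
  by have [a Ia] := onto q; exists a; exact: edge_ideal_suspension.
have augE p : aug (p *: oneG) = p * aug oneG by rewrite linearZ.
have [a1 Ia1] := onto 1; have [v [aE _]] := dga_degree0 hGdg a1.
rewrite aE augE in Ia1.
have [q [-> _]] := dga_degree0 hGdg a; rewrite augE.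
have bE b : dif P 0%N b = q *: oneG <->
    dif G 0%N b.1 = (q - z * taylor0 (dif K 0%N b.2)) *: oneG.
  rewrite cone_dif0 (linearZ_of (@taylor0_linear _ _ _ C ltC (@vert_mon n))).
  rewrite scalerBl; split=> [<-|->]; first by rewrite addrK.
  by rewrite subrK.
have -> : (exists b, dif P 0%N b = q *: oneG) <->
    (exists2 p, I p & exists c : 'I_n -> Q, q = p + z * \sum_(v in C) c v * 'X_(vert v)).
  split=> [[b /bE db]|[p Ip [c qE]]].
    exists (q - z * taylor0 (dif K 0%N b.2)).
      by apply/boundary_degree0; exists b.1.
    have [c cE] := (koszulK_dif0_ideal hltC _).1 (ex_intro _ (b.2 : K 1%N) erefl).
    by exists c; rewrite -cE subrK.
  have [f fE] := (koszulK_dif0_ideal hltC _).2 (ex_intro _ c erefl).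
  have [a0 da0] := (boundary_degree0 p).2 Ip.
  by exists (a0, f); apply/bE; rewrite [LHS]/= da0 fE qE addrK.
rewrite -suspension_ideal; exact: edge_ideal_unit (edge_ideal_suspension C Ia1).
Qed.

Lemma cone_free_resolution : free_resolution P (edge_ideal k (suspension E C)).
Proof.
have [_ freeG _ _] := hGres.
have freeF i : fg_free (F i) := is_basis_fg_free (@taylor_basis k n.+1 _ C i).
split; [exact: cone_complex | | exact: cone_exact | exact: cone_degree0].
by case=> [|[|i]]; do ?[apply: fg_free_pair | exact: freeG | exact: freeF].
Qed.

End SuspensionResolution.

(** * Minimality *)

Section MaximalIdeal.
Variables (k : fieldType) (N : nat).
Notation Q := {mpoly k[N]}.
Implicit Types V W : lmodType Q.

(** Membership in the homogeneous maximal ideal times V, as required of boundaries by [minimal]. *)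
Definition in_max V (x : V) : Prop :=
  exists c : 'I_N -> V, x = \sum_(v < N) 'X_v *: c v.

Lemma in_max0 V : in_max (0 : V).
Proof. by exists (fun=> 0); rewrite big1 // => v _; exact: scaler0. Qed.

Lemma in_maxD V (x y : V) : in_max x -> in_max y -> in_max (x + y).
Proof.
move=> [c ->] [d ->]; exists (fun v => c v + d v).
by rewrite -big_split; apply: eq_bigr => v _; rewrite scalerDr.
Qed.

Lemma in_max_linear V W (f : V -> W) x : linear f -> in_max x -> in_max (f x).
Proof.
move=> hf [c ->]; exists (f \o c); rewrite (linear_sum_of hf).
by apply: eq_bigr => v _; rewrite (linearZ_of hf).
Qed.

Lemma in_maxZ V q (x : V) : in_max x -> in_max (q *: x).
Proof.
by apply: in_max_linear => a y t; rewrite scalerDr !scalerA mulrC.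
Qed.

Lemma in_maxN V (x : V) : in_max x -> in_max (- x).
Proof. by rewrite -scaleN1r; exact: in_maxZ. Qed.

Lemma in_max_sum V (J : Type) (r : seq J) (A : pred J) (F : J -> V) :
  (forall j, A j -> in_max (F j)) -> in_max (\sum_(j <- r | A j) F j).
Proof. by move=> h; elim/big_ind: _ => //; [exact: in_max0 | exact: in_maxD]. Qed.

Lemma in_max_var V v (x : V) : in_max ('X_v *: x).
Proof.
exists (fun w => if w == v then x else 0); rewrite (bigD1 v) //= eqxx big1 ?addr0 //.
by move=> w /negPf ->; rewrite scaler0.
Qed.

Lemma in_max_mono V (m : 'X_{1..N}) (x : V) : m != 0%MM -> in_max ('X_[m] *: x).
Proof.
move=> m0; have [v mv] : exists v, m v != 0%N.
  apply/existsP; apply: contra_neqT m0; rewrite negb_exists => /forallP h.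
  by apply/mnmP => v; rewrite mnm0E; apply/eqP; have := h v; rewrite negbK.
have -> : m = (U_(v) + (m - U_(v)))%MM by rewrite addmC submK // lep1mP.
by rewrite mpolyXD -scalerA; exact: in_max_var.
Qed.

Lemma in_max_pair V W (x : V * W) : in_max x.1 -> in_max x.2 -> in_max x.
Proof.
case: x => x y [c /= ->] [d ->]; exists (fun v => (c v, d v)).
by apply: pair_ext; rewrite /= (raddf_sum fst, raddf_sum snd).
Qed.

End MaximalIdeal.

(** * Covers, co-covers and oriented cycles *)

Section CoverMap.
Variables (n : nat) (E : {set {set 'I_n}}) (C : {set 'I_n}) (X : {set 'I_n} -> 'I_n).
Hypotheses (hE : simple_graph E) (hX : cover_map E C X).

Lemma edge_monE (w : {set 'I_n}) j : edge_mon w j = (j \in (@vert n) @: w).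
Proof.
rewrite /edge_mon mnm_sumE; apply/eqP.
case: imsetP => [[v vw ->]|ne].
  rewrite (bigD1 v) //= mnm1E eqxx big1 // => u /andP[_ uv].
  by rewrite mnm1E (inj_eq (@vert_inj n)) (negPf uv).
rewrite big1 // => v vw; rewrite mnm1E; case: eqVneq => // vj.
by case: ne; exists v.
Qed.

Lemma co_cover_exists w : w \in E ->
  exists2 v, v != X w & w = [set v; X w].
Proof.
move=> wE; have [_ Xw] := hX wE.
have [a [b [ab wab]]] : exists a b, a != b /\ w = [set a; b].
  by have /eqP/cards2P[a [b [ab wab]]] := hE wE; exists a, b.
have : X w \in [set a; b] by rewrite -wab.
case/set2P => ->; [exists b | exists a] => //; first by rewrite eq_sym.
by rewrite setUC.
Qed.

Lemma acyclic_y_lcm (W : {set {set 'I_n}}) :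
  no_oriented_cycle (cover_digraph E X) -> W \subset E -> W != set0 ->
  #|X @: W| == #|W| -> (y_lcm X W - xy_gcd X W != 0)%MM.
Proof.
move=> acyc /subsetP sW /set0Pn[w0 w0W] /imset_injP Xinj; apply/negP => /eqP yx0.
(* If y_W / d_W is 1, then y_W divides x_W, so the co-cover of w is the cover of some w' in W. *)
have next w : w \in W -> exists2 w', w' \in W & (X w' != X w) && (w == [set X w'; X w]).
  move=> wW; have wE := sW w wW; have [v vX wv] := co_cover_exists wE.
  have yv : (0 < y_lcm X W (vert v))%N.
    rewrite lcm_setE; apply: leq_trans (leq_bigmax_cond _ wW).
    rewrite mnmBE edge_monE imset_f ?mnm1E ?(inj_eq (@vert_inj n)); last by rewrite wv set21.
    by rewrite eq_sym (negPf vX).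
  have : (0 < x_lcm X W (vert v))%N.
    have := congr1 (fun m : 'X_{1..n.+1} => m (vert v)) yx0.
    by rewrite mnmBE mnm0E mnmE; move: yv; lia.
  rewrite lcm_setE; case: (boolP [exists w' in W, X w' == v]).
    case/existsP => w' /andP[w'W /eqP Xw']; exists w' => //.
    by rewrite Xw' vX [w in w == _]wv eqxx.
  rewrite negb_exists => /forallP h; rewrite big1 // => w' w'W.
  by rewrite mnm1E (inj_eq (@vert_inj n)); have := h w'; rewrite w'W /= => /negPf ->.
(* By [next], the default value is never taken on W. *)
pose f w := if [pick w' in W | (X w' != X w) && (w == [set X w'; X w])] is Some w'
            then w' else w.
have fP w : w \in W -> [/\ f w \in W, X (f w) != X w & w = [set X (f w); X w]].
  move=> wW; rewrite /f; case: pickP => [w' /andP[w'W /andP[Xw' /eqP wE]]|h].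
    by split.
  by have [w' w'W h'] := next w wW; have := h w'; rewrite w'W h'.
have fW i w : w \in W -> iter i f w \in W.
  by move=> wW; elim: i => //= i /fP[].
(* The iterates of f at w0 must repeat, which yields an edge w on a closed orbit. *)
have /trajectP[i lti iE] := looping_order f w0.
pose w := iter i f w0; have wW : w \in W by apply: fW.
have cyc : fcycle f (orbit f w).
  apply/(orbitPcycle 3 0); exists (order f w0 - i).-1.
  rewrite prednK ?subn_gt0 // /w -iterD subnK ?iE //; exact: ltnW.
have oW u : u \in orbit f w -> u \in W.
  by rewrite -fconnect_orbit => /iter_findex <-; apply: fW.
(* The arrow of w runs from X (f w) to X w, against f, hence the reversal. Injectivity of X on W
   makes the vertices distinct. *)
apply: (acyc (map X (rev (orbit f w)))).
  rewrite -size_eq0 size_map size_rev size_orbit -lt0n; exact: order_gt0.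
rewrite /ucycle map_inj_in_uniq ?rev_uniq ?orbit_uniq ?andbT; last first.
  by move=> u v; rewrite !mem_rev => /oW uW /oW vW; apply: Xinj.
rewrite cycle_map rev_cycle; apply: (sub_in_cycle (P := mem W) _ _ cyc);
  last by apply/allP => u; exact: oW.
move=> u v uW _ /eqP <- /=; have [_ _ uE] := fP u uW.
by rewrite /cover_digraph -uE sW //= eqxx.
Qed.

(** Each edge is the product of its cover and its co-cover, which are coprime. *)
Lemma lcm_edge_mon (W : {set {set 'I_n}}) j : W \subset E ->
  lcm_set (@edge_mon n) W j = maxn (x_lcm X W j) (y_lcm X W j).
Proof.
move=> /subsetP sW.
have split w : w \in W ->
    edge_mon w j = maxn (vert_mon (X w) j) ((edge_mon w - vert_mon (X w))%MM j).
  move=> wW; have [_ Xw] := hX (sW w wW); rewrite mnmBE edge_monE mnm1E.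
  by case: eqVneq => [<-|_]; [rewrite imset_f | rewrite subn0 max0n].
apply/eqP; rewrite eqn_leq; apply/andP; split.
  rewrite lcm_setE; apply/bigmax_leqP => w wW; rewrite split // !lcm_setE.
  by rewrite geq_max !leq_max !(leq_bigmax_cond _ wW) orbT.
rewrite geq_max !lcm_setE; apply/andP; split; apply/bigmax_leqP => w wW;
  by apply: leq_trans (leq_bigmax_cond _ wW); rewrite split // leq_max leqnn ?orbT.
Qed.

Lemma lcm_cover_image (W : {set {set 'I_n}}) :
  lcm_set (@vert_mon n) (X @: W) = x_lcm X W.
Proof.
apply/mnmP => j; apply/eqP; rewrite eqn_leq !lcm_setE; apply/andP; split.
  by apply/bigmax_leqP => _ /imsetP[w wW ->]; exact: leq_bigmax_cond wW.
by apply/bigmax_leqP => w wW; exact: leq_bigmax_cond (imset_f X wW).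
Qed.

End CoverMap.

(** * Elements of a given multidegree *)

Section Homogeneous.
Variables (k : fieldType) (N : nat).
Notation Q := {mpoly k[N]}.
Implicit Types (m d : 'X_{1..N}).

(** The shape that [multigraded_by] requires of the boundary of a basis element of degree d, stated
    for arbitrary elements. *)
Definition homogeneous (V : lmodType Q) (Y : finType) (b : Y -> V)
    (deg : Y -> 'X_{1..N}) d (x : V) : Prop :=
  exists c : Y -> k,
    x = \sum_(y | (deg y <= d)%MM) ((c y)%:MP * 'X_[(d - deg y)%MM]) *: b y.

Section OneBasis.
Variables (V : lmodType Q) (Y : finType) (b : Y -> V) (deg : Y -> 'X_{1..N}).
Notation H := (homogeneous b deg).

Lemma homog0 d : H d 0.
Proof. by exists (fun=> 0); rewrite big1 // => y _; rewrite mpolyC0 mul0r scale0r. Qed.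

Lemma homogD d x y : H d x -> H d y -> H d (x + y).
Proof.
move=> [c ->] [c' ->]; exists (fun y => c y + c' y); rewrite -big_split.
by apply: eq_bigr => w _; rewrite mpolyCD mulrDl scalerDl.
Qed.

Lemma homogN d x : H d x -> H d (- x).
Proof.
move=> [c ->]; exists (fun y => - c y); rewrite -sumrN.
by apply: eq_bigr => w _; rewrite mpolyCN mulNr scaleNr.
Qed.

Lemma homog_sum d (J : Type) (r : seq J) (A : pred J) (F : J -> V) :
  (forall j, A j -> H d (F j)) -> H d (\sum_(j <- r | A j) F j).
Proof. by move=> h; elim/big_ind: _ => //; [exact: homog0 | exact: homogD]. Qed.

Lemma homog_sign d s x : H d x -> H d ((-1) ^+ s *: x).
Proof.
move=> hx; rewrite -signr_odd; case: odd; last by rewrite expr0 scale1r.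
by rewrite expr1 scaleN1r; apply: homogN.
Qed.

Lemma homog_basis m y d : (m + deg y)%MM = d -> H d ('X_[m] *: b y).
Proof.
move=> <-; exists (fun y' => (y' == y)%:R); rewrite (bigD1 y) ?lem_addl //= big1 ?addr0.
  by rewrite eqxx mpolyC1 mul1r addmK.
by move=> y' /andP[_ /negPf ->]; rewrite mpolyC0 mul0r scale0r.
Qed.

(** Serves the third component of the cone, a copy of G with all degrees shifted by z. *)
Lemma homog_shift m d x : H d x -> homogeneous b (fun y => deg y + m)%MM (d + m)%MM x.
Proof.
move=> [c ->]; exists c.
have le y : (deg y + m <= d + m)%MM = (deg y <= d)%MM.
  by apply/mnm_lepP/mnm_lepP => h i; have := h i; rewrite !mnmDE leq_add2r.
rewrite (eq_bigl _ _ le); apply: eq_bigr => y _; congr (_ * 'X_[_] *: _).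
by apply/mnmP => i; rewrite !mnmBE !mnmDE subnDr.
Qed.

End OneBasis.

Lemma homog_pair (V W : lmodType Q) (Y Z : finType) (b : Y -> V) (b' : Z -> W)
    (deg : Y -> 'X_{1..N}) (deg' : Z -> 'X_{1..N}) d x x' :
  homogeneous b deg d x -> homogeneous b' deg' d x' ->
  homogeneous (pair_basis b b')
    (fun s => match s with inl y => deg y | inr y => deg' y end) d (x, x').
Proof.
move=> [c ->] [c' ->]; exists (fun s => match s with inl y => c y | inr y => c' y end).
by rewrite (pair_basis_sum _ _ _ (fun s => _ * _)).
Qed.

End Homogeneous.

Section SuspensionMinimal.
Variables (k : fieldType) (n : nat) (E : {set {set 'I_n}}) (C : {set 'I_n}).
Variables (X : {set 'I_n} -> 'I_n) (ltE : rel {set 'I_n}) (ltC : rel 'I_n).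
Hypotheses (hE : simple_graph E) (hX : cover_map E C X).
Hypothesis hltC : strict_total_order C ltC.
Notation Q := {mpoly k[n.+1]}.
Notation K := (koszulK k C ltC).
Notation F := (taylorF k C ltC).
Notation z := ('X_ord_max : Q).
Variables (G : complex Q) (oneG : G 0%N) (pi : gmap (taylorT k E ltE) G).
Variable B : {set {set {set 'I_n}}}.
Hypothesis hB : forall i, is_basis (basisG pi B i).
Variable tau : gmap G K.
Hypothesis htau : tau_formula X pi B tau.
Notation P := (cone (beta oneG tau)).

Lemma cellBP i (W : cellB E B i) :
  val (val W) \subset E /\ #|val (val W)| = i.
Proof. exact: cellP. Qed.

Lemma tau_in_max i (c : G i.+1) :
  no_oriented_cycle (cover_digraph E X) -> in_max (tau i.+1 c).
Proof.
move=> acyc; have [f [-> _]] := hB c.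
rewrite linear_sum; apply: in_max_sum => W _; rewrite linearZ; apply: in_maxZ.
rewrite htau; case: ifP => [Wcard|_]; last by rewrite scaler0; exact: in_max0.
have [sW cW] := cellBP W; apply: in_max_mono.
apply: (acyclic_y_lcm hE hX) => //.
by rewrite -cards_eq0 cW.
Qed.

Lemma koszulK_in_max i (x : K i.+1) : in_max (dif K i x).
Proof.
rewrite (taylor_sum x) dif_sum; apply: in_max_sum => U _.
rewrite difZ; apply: in_maxZ; have [sU cU] := cellP U.
rewrite (koszulK_tgen_dif _ _ sU cU); apply: in_max_sum => v vU.
by rewrite -scalerA; apply: in_maxZ; exact: in_max_var.
Qed.

Lemma cone_minimal : no_oriented_cycle (cover_digraph E X) ->
  minimal G -> minimal P.
Proof.
move=> acyc minG; have mG i (a : G i.+1) : in_max (dif G i a) by exact: minG.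
have mz i (c : G i) : in_max (- (z *: c)) by apply/in_maxN/in_max_var.
have mK i (b : K i.+2) (c : G i.+1) : in_max (dif K i.+1 b + tau i.+1 c).
  by apply: in_maxD; [exact: koszulK_in_max | exact: tau_in_max].
move=> [|[|i]] x; rewrite -/(in_max _).
- rewrite cone_dif0; apply: in_maxD; first exact: mG.
  rewrite (linearZ_of (@taylor0_linear _ _ _ C ltC (@vert_mon n))).
  by rewrite -scalerA; exact: in_max_var.
- by rewrite cone_dif1; apply: in_max_pair => /=; [exact: in_maxD | exact: mK].
- rewrite cone_difS; apply: in_max_pair; first exact: in_maxD.
  by apply: in_max_pair; [exact: mK | apply/in_maxN/mG].
Qed.

End SuspensionMinimal.

(** * The multigrading *)

Section SuspensionMultigraded.
Variables (k : fieldType) (n : nat) (E : {set {set 'I_n}}) (C : {set 'I_n}).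
Variables (X : {set 'I_n} -> 'I_n) (ltE : rel {set 'I_n}) (ltC : rel 'I_n).
Hypothesis hX : cover_map E C X.
Hypothesis hltC : strict_total_order C ltC.
Notation Q := {mpoly k[n.+1]}.
Notation K := (koszulK k C ltC).
Notation F := (taylorF k C ltC).
Notation z := ('X_ord_max : Q).
Variables (G : complex Q) (oneG : G 0%N) (pi : gmap (taylorT k E ltE) G).
Hypothesis one_degree0 : forall a : G 0%N, exists! q : Q, a = q *: oneG.
Hypothesis pi_one : pi 0%N (taylorT_one k E ltE) = oneG.
Variable B : {set {set {set 'I_n}}}.
Hypothesis hB : forall i, is_basis (basisG pi B i).
Hypothesis hG : multigraded_by (basisG pi B) (degG E B).
Variable tau : gmap G K.
Hypothesis htau : tau_formula X pi B tau.
Notation P := (cone (beta oneG tau)).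
Notation HG := (fun i => homogeneous (basisG pi B i) (degG E B i)).

(** The only cell of degree 0 is the empty set. Were it missing from B, then G_0 would be zero and
    the coefficient of [oneG] would not be unique. *)
Lemma one_basisG : exists W : cellB E B 0,
  basisG pi B 0 W = oneG /\ degG E B 0 W = 0%MM.
Proof.
have [W _|none] := pickP (@predT (cellB E B 0)).
  have [_ /cards0_eq W0] := cellBP W.
  by exists W; rewrite /basisG /degG W0 lcm_set0.
have [f [oneE _]] := hB oneG.
have one0 : oneG = 0 by rewrite oneE big1 // => W _; have := none W.
have [q [_ uq]] := one_degree0 0.
have := uq 1; rewrite one0 !scaler0 => /(_ erefl) q1.
have := uq 0; rewrite one0 !scaler0 => /(_ erefl) q0.
by have := oner_neq0 Q; rewrite -q1 q0 eqxx.
Qed.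

(** For nonempty U this is the lcm of the monomials z x. Only positive degrees of F occur in the
    cone. *)
Definition degF i (U : cell C i) : 'X_{1..n.+1} :=
  (z_mon n + lcm_set (@vert_mon n) (val U))%MM.

Definition genF i (U : cell C i) : F i := tgen C i (val U).

Notation HF := (fun i => homogeneous (@genF i) (@degF i)).

Lemma lcm_vert_face (U : {set 'I_n}) v : v \in U ->
  lcm_set (@vert_mon n) U = (lcm_set (@vert_mon n) (U :\ v) + U_(vert v))%MM.
Proof.
move=> vU; rewrite -(lcm_var_face (@vert_inj n) vU).
apply/mnmP => j; rewrite mnmDE mnmBE subnKC //.
exact: leq_lcm_set (subD1set U v).
Qed.

Lemma genF_homog i (U : cell C i.+2) : HF i.+1 (degF U) (dif K i.+1 (genF U)).
Proof.
have [sU cU] := cellP U.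
rewrite /genF (koszulK_tgen_dif _ _ sU cU); apply: homog_sum => v vU.
rewrite -scalerA; apply: homog_sign.
have hUv : (val U :\ v \subset C) && (#|val U :\ v| == i.+1).
  rewrite (subset_trans (subD1set _ _)) //=.
  by move: cU; rewrite (cardsD1 v) vU add1n => -[->].
apply: (@homog_basis _ _ _ _ _ _ _ (Sub (val U :\ v) hUv : cell C i.+1)).
by rewrite /degF /= (lcm_vert_face vU) addmC addmA.
Qed.

Lemma tau_homog i (W : cellB E B i.+1) :
  HF i.+1 (degG E B i.+1 W + z_mon n)%MM (tau i.+1 (basisG pi B i.+1 W)).
Proof.
have [sW cW] := cellBP W.
rewrite htau; case: ifP => [/eqP Wcard|_]; last by rewrite scaler0; exact: homog0.
have hXW : (X @: val (val W) \subset C) && (#|X @: val (val W)| == i.+1).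
  rewrite Wcard cW eqxx andbT; apply/subsetP => _ /imsetP[w wW ->].
  by case: (hX (subsetP sW w wW)).
apply: (@homog_basis _ _ _ _ _ _ _ (Sub (X @: val (val W)) hXW : cell C i.+1)).
(* Here lcm W = lcm(x_W, y_W) = (y_W / d_W) x_W, and x_W is the degree of the Koszul generator; z is
   added on both sides. *)
apply/mnmP => j; rewrite /degF /degG /= lcm_cover_image.
rewrite !mnmDE (lcm_edge_mon hX) // mnmBE [xy_gcd _ _ _]mnmE; lia.
Qed.

Definition M_index i : finType :=
  match i with
  | 0%N => (cell C 1 : finType)
  | i'.+1 => (cell C i'.+2 + cellB E B i'.+1 : finType)%type
  end.

Definition M_basis i : M_index i -> M_obj G F i :=
  match i return M_index i -> M_obj G F i with
  | 0%N => @genF 1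
  | i'.+1 => pair_basis (@genF i'.+2) (basisG pi B i'.+1)
  end.

(** The shift by z on the copy of G makes multiplication by - z in [beta] homogeneous. *)
Definition M_deg i : M_index i -> 'X_{1..n.+1} :=
  match i return M_index i -> 'X_{1..n.+1} with
  | 0%N => @degF 1
  | i'.+1 => fun s => match s with
             | inl U => degF U
             | inr W => (degG E B i'.+1 W + z_mon n)%MM
             end
  end.

Definition P_index i : finType :=
  match i with
  | 0%N => (cellB E B 0 : finType)
  | i'.+1 => (cellB E B i'.+1 + M_index i' : finType)%type
  end.

Definition P_basis i : P_index i -> P i :=
  match i return P_index i -> P i with
  | 0%N => basisG pi B 0
  | i'.+1 => pair_basis (basisG pi B i'.+1) (@M_basis i')
  end.

Definition P_deg i : P_index i -> 'X_{1..n.+1} :=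
  match i return P_index i -> 'X_{1..n.+1} with
  | 0%N => degG E B 0
  | i'.+1 => fun s => match s with
             | inl W => degG E B i'.+1 W
             | inr m => M_deg m
             end
  end.

Lemma P_is_basis i : is_basis (@P_basis i).
Proof.
case: i => [|[|i]]; do ?[exact: hB | exact: taylor_basis | apply: is_basis_pair].
Qed.

Lemma cone_multigraded : multigraded P.
Proof.
exists P_index, P_basis, P_deg; split; first exact: P_is_basis.
have hdG i (W : cellB E B i.+1) : HG i (degG E B i.+1 W) (dif G i (basisG pi B i.+1 W)).
  exact: hG.2.
(* A basis element of the cone has one nonzero component; the facts about 0 take care of the
   others. *)
have hdG0 i d : HG i d (dif G i 0) by rewrite dif0; exact: homog0.
have hF0 i d : HF i d 0 by exact: (homog0 (@genF i) (@degF i) d).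
have hdK0 i d : HF i.+1 d (dif K i.+1 0) by rewrite dif0; exact: hF0.
have htau0 i d : HF i.+1 d (tau i.+1 0) by rewrite raddf0; exact: hF0.
have hz0 i d : HG i d (- (z *: 0)) by rewrite scaler0 oppr0; exact: homog0.
have hz i (W : cellB E B i) :
    HG i (degG E B i W + z_mon n)%MM (- (z *: basisG pi B i W)).
  by apply/homogN/homog_basis; rewrite addmC.
have hdGz i (W : cellB E B i.+1) : homogeneous (basisG pi B i)
    (fun V => degG E B i V + z_mon n)%MM (degG E B i.+1 W + z_mon n)%MM
    (- dif G i (basisG pi B i.+1 W)).
  by apply/homogN/homog_shift/hdG.
have hdGz0 i d : homogeneous (basisG pi B i)
    (fun V => degG E B i V + z_mon n)%MM d (- dif G i 0).
  by rewrite dif0 oppr0; exact: homog0.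
have h0 (a : G 1%N) (b : K 1%N) d : HG 0%N d (dif G 0%N a) ->
    HG 0%N d ((z *: (taylor0 (dif K 0%N b) : Q^o)) *: oneG) ->
    HG 0%N d (dif P 0%N ((a, b) : P 1%N)).
  move=> ha hb; rewrite cone_dif0; apply: homogD ha _.
  by rewrite (linearZ_of (@taylor0_linear _ _ _ C ltC (@vert_mon n))).
have h1 (a : G 2%N) (b : K 2%N) (c : G 1%N) d : HG 1%N d (dif G 1%N a) ->
    HG 1%N d (- (z *: c)) -> HF 1%N d (dif K 1%N b) -> HF 1%N d (tau 1%N c) ->
    homogeneous (@P_basis 1) (@P_deg 1) d (dif P 1%N ((a, (b, c)) : P 2%N)).
  move=> ha hc hb ht; rewrite cone_dif1; apply: homog_pair; first exact: homogD.
  exact: (homogD (V := F 1%N) hb ht).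
have hS i (a : G i.+3) (b : K i.+3) (c : G i.+2) d : HG i.+2 d (dif G i.+2 a) ->
    HG i.+2 d (- (z *: c)) -> HF i.+2 d (dif K i.+2 b) -> HF i.+2 d (tau i.+2 c) ->
    homogeneous (basisG pi B i.+1) (fun V => degG E B i.+1 V + z_mon n)%MM d
      (- dif G i.+1 c) ->
    homogeneous (@P_basis i.+2) (@P_deg i.+2) d (dif P i.+2 ((a, (b, c)) : P i.+3)).
  move=> ha hc hb ht hdc; rewrite cone_difS; apply: homog_pair; first exact: homogD.
  by apply: homog_pair hdc; exact: (homogD (V := F i.+2) hb ht).
case=> [|[|i]] x; rewrite -/(homogeneous _ _ _ _).
- case: x => [W|U]; apply: h0.
  + exact: hdG.
  + rewrite dif0 (_ : taylor0 0 = 0) ?scaler0 ?scale0r; first exact: homog0.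
    by rewrite /taylor0 big1 // => V _; rewrite ffunE.
  + exact: hdG0.
  (* The generator of F_1 at {v} has boundary z times the variable of v, times the unit. *)
  have [sU /eqP/cards1P[v Uv]] := cellP U.
  have vC : v \in C by rewrite -sub1set -Uv.
  have -> : taylor0 (dif K 0%N (tgen C 1 (val U))) = 'X_(vert v) :> Q.
    rewrite Uv (koszulK_dif1 _ hltC vC).
    apply: etrans (linearZ_of (@taylor0_linear _ _ _ C ltC (@vert_mon n)) _ _) _.
    by rewrite taylor0_one; exact: mulr1.
  have [W0 [<- W0deg]] := one_basisG.
  have -> : z *: ('X_(vert v) : Q^o) = 'X_[(z_mon n + U_(vert v))%MM].
    by rewrite mpolyXD.
  apply: homog_basis; rewrite W0deg addm0 /P_deg /M_deg /degF Uv.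
  by rewrite lcm_set1.
- case: x => [W|[U|W]]; apply: h1;
    try solve [exact: hdG | exact: hdG0 | exact: hz | exact: hz0 | exact: hdK0
              | exact: htau0 | exact: genF_homog | exact: tau_homog].
- case: x => [W|[U|W]]; apply: hS;
    try solve [exact: hdG | exact: hdG0 | exact: hz | exact: hz0 | exact: hdK0
              | exact: htau0 | exact: genF_homog | exact: tau_homog
              | exact: hdGz | exact: hdGz0].
Qed.

End SuspensionMultigraded.

Theorem theorem4p17 (k : fieldType) (n : nat)
    (E : {set {set 'I_n}}) (C : {set 'I_n}) (X : {set 'I_n} -> 'I_n)
    (ltE : rel {set 'I_n}) (ltC : rel 'I_n)
    (hE : simple_graph E) (hC : vertex_cover E C) (hX : cover_map E C X)
    (hltE : strict_total_order E ltE) (hltC : strict_total_order C ltC)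
    (hlt : {in E &, forall w w' : {set 'I_n}, ltC (X w) (X w') -> ltE w w'})
    (* the minimal free resolution G of Q/I(G), a strictly commutative dg
       algebra *)
    (G : complex {mpoly k[n.+1]}) (oneG : G 0%N) (mulG : products G)
    (hGdg : dg_algebra oneG mulG) (hGcomm : strictly_commutative mulG)
    (hGres : minimal_free_resolution G (edge_ideal k (extend_graph E)))
    (* its identification with T/J, and its basis of images of certain g_W *)
    (J : forall i, taylorT k E ltE i -> Prop)
    (pi : gmap (taylorT k E ltE) G)
    (hJ : dg_ideal (taylorT_mul k n E ltE) J)
    (hpi : dg_quotient (taylorT_one k E ltE) (taylorT_mul k n E ltE)
             oneG mulG J pi)
    (B : {set {set {set 'I_n}}})
    (hB : forall i, is_basis (basisG pi B i))
    (tau : gmap G (koszulK k C ltC))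
    (htau_chain : chain_map tau)
    (htau_one : tau 0%N oneG = koszulK_one k C ltC)
    (htau : tau_formula X pi B tau) :
  (no_oriented_cycle (cover_digraph E X) ->
     minimal_free_resolution (cone (beta oneG tau))
       (edge_ideal k (suspension E C)) /\
     (multigraded_by (basisG pi B) (degG E B) ->
        multigraded (cone (beta oneG tau)))) /\
  (dg_morphism oneG mulG (koszulK_one k C ltC) (koszulK_mul k n C ltC) tau ->
     exists (one : cone (beta oneG tau) 0%N)
            (mul : products (cone (beta oneG tau))),
       dg_algebra one mul /\ strictly_commutative mul).
Proof.
have [gres gmin] := hGres; have [[_ pi_one _] _ _] := hpi.
split=> [acyc|htau_dg]; last exact: (suspension_dg_algebra hltC hGdg hGcomm).
split; first split.
- exact: (cone_free_resolution hltC hGdg gres htau_chain htau_one).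
- exact: (cone_minimal hE hX hB htau acyc gmin).
move=> hG.
exact: (cone_multigraded hX hltC (dga_degree0 hGdg) pi_one hB hG htau).
Qed.
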